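(* Let $K\ge1$, let $p\ge1$ be an integer, and let $F$ be a $K$-quasiregular polyharmonic mapping in $\mathbb{D}$ of the form $$F(z)=a_0+\sum_{k=1}^p|z|^{2(k-1)}\sum_{n=1}^\infty\left(a_{n,k}z^n+\overline{b_{n,k}z^n}\right),$$ such that, for every $n\ge1$ and all $k_1,k_2,k_3,k_4\in\{1,\dots,p\}$, all non-zero coefficients $a_{n,k_1},a_{n,k_2}$ and $b_{n,k_3},b_{n,k_4}$ satisfy $$\left|\arg\frac{a_{n,k_1}}{a_{n,k_2}}\right|\le\frac{\pi}{2}\quad\text{and}\quad\left|\arg\frac{b_{n,k_3}}{b_{n,k_4}}\right|\le\frac{\pi}{2}.$$ Suppose $\lambda_F(z)\le\lambda$ for all $z\in\mathbb{D}$, where $\lambda$ is a constant. Then $$|a_{n,k}|+|b_{n,k}|\le\frac{\lambda\sqrt{K^2+1}}{n}\quad\text{for all } n\ge2,\ k=1,$$ $$|a_{n,k}|+|b_{n,k}|\le\frac{\lambda\sqrt{K^2+1}}{\sqrt{10}}\quad\text{for all } n\ge2,\ 2\le k\le p,$$ $$|a_{n,k}|+|b_{n,k}|\le\frac{\lambda\sqrt{K^2+1}}{\sqrt{5}}\quad\text{for } n=1,\ 2\le k\le p.$$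
   Context: $\mathbb{D}=\{z\in\mathbb{C}:|z|<1\}$. For a continuously differentiable complex-valued $f$ put $\Lambda_f(z)=|f_z(z)|+|f_{\bar z}(z)|$, $\lambda_f(z)=\big||f_z(z)|-|f_{\bar z}(z)|\big|$, $J_f(z)=|f_z(z)|^2-|f_{\bar z}(z)|^2$. A $2p$-times continuously differentiable complex-valued $F$ is polyharmonic if $\Delta^pF=0$, where $\Delta=4\partial^2/\partial z\partial\bar z$. In $\mathbb{D}$ this is equivalent to $F(z)=\sum_{k=1}^p|z|^{2(k-1)}G_{p-k+1}(z)$ with all $G_{p-k+1}$ complex-valued harmonic in $\mathbb{D}$. In the series representation in the claim, for each $k$ the functions $\sum_{n\ge1}a_{n,k}z^n$ and $\sum_{n\ge1}b_{n,k}z^n$ are analytic in $\mathbb{D}$. A $K$-quasiregular mapping ($K\ge1$) is a sense-preserving continuous mapping $f:\mathbb{D}\to\mathbb{C}$ that is $ACL^2$ (absolutely continuous on almost every horizontal and vertical line in each closed rectangle in $\mathbb{D}$ with sides parallel to the axes, with locally $L^2$ partial derivatives), with $J_f\ne0$ a.e. and $\Lambda_f^2\le KJ_f$ a.e. in $\mathbb{D}$. (For a continuously differentiable $f$, which is automatically $ACL^2$, sense-preserving is taken to mean $J_f\ge0$, so that $J_f>0$ a.e.; the inequality is then equivalent to $\Lambda_f\le K\lambda_f$.) $\arg$ denotes the principal argument, in $(-\pi,\pi]$. *)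

(* Defs.v *)
From HB Require Import structures.
From mathcomp Require Import all_boot all_order all_algebra.
From mathcomp Require Import all_classical all_reals all_analysis.
From mathcomp Require Export complex.

Set Implicit Arguments.
Unset Strict Implicit.
Unset Printing Implicit Defensive.

Import Order.TTheory GRing.Theory Num.Theory numFieldNormedType.Exports.
Import Normc.

Local Open Scope classical_set_scope.
Local Open Scope ring_scope.
Local Open Scope complex_scope.

(* The library gives [R[i]] its norm but no topology; these instances transfer
   the normed topology that every numeric field [K] carries on [K^o]. *)
Set Warnings "-redundant-canonical-projection".
HB.instance Definition _ (R : realType) := GRing.ComAlgebra.copy R[i] R[i]^o.
HB.instance Definition _ (R : realType) := Vector.copy R[i] R[i]^o.
HB.instance Definition _ (R : realType) := NormedModule.copy R[i] R[i]^o.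

Section Definitions.
Variable R : realType.
Implicit Types (f : R[i] -> R[i]) (z : R[i]) (c : nat -> R[i]).

(* [normc] with codomain the carrier of the field [R] itself, so that the
   canonical structures of [R] are inferred on its values. *)
Definition modulus z : R := normc z.

Lemma norm_modulus z : `|z| = (modulus z)%:C.
Proof. by []. Qed.

Definition disk : set R[i] := [set z | modulus z < 1].

Definition principal_arg z : R :=
  get [set t : R | - pi < t <= pi /\
                   z = (modulus z * cos t) +i* (modulus z * sin t)].

Lemma principal_argP z : z != 0 ->
  - pi < principal_arg z <= pi /\
  z = (modulus z * cos (principal_arg z)) +i* (modulus z * sin (principal_arg z)).
Proof.
move=> z0; rewrite /principal_arg; case: xgetP => [t _ //|none].
case: z z0 none => x y z0 none; exfalso.
set r := modulus (x +i* y) in none.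
have r0 : r != 0 by apply: contra z0 => /eqP/eq0_normc ->.
have r_gt0 : 0 < r by rewrite lt_neqAle eq_sym r0 /r /modulus /= sqrtr_ge0.
have r2 : r ^+ 2 = x ^+ 2 + y ^+ 2.
  by rewrite /r /modulus /= sqr_sqrtr// addr_ge0// sqr_ge0.
have xr2 : (x / r) ^+ 2 <= 1.
  by rewrite expr_div_n ler_pdivrMr ?exprn_gt0// mul1r r2 lerDl sqr_ge0.
have xr1 : -1 <= x / r <= 1.
  by rewrite -ler_norml -(@ler_pXn2r _ 2%N)// ?nnegrE//
             real_normK ?num_real// expr1n.
have rx : r * (x / r) = x by rewrite mulrC divfK.
have cosa : r * cos (acos (x / r)) = x.
  by rewrite acosK ?in_itv.
have sina : r * sin (acos (x / r)) = `|y|.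
  have -> : `|y| = Num.sqrt (r ^+ 2 * (1 - (x / r) ^+ 2)).
    by rewrite mulrBr mulr1 -exprMn rx r2 addrAC subrr add0r sqrtr_sqr.
  by rewrite sin_acos// sqrtrM ?sqr_ge0// sqrtr_sqr gtr0_norm.
have [y0|y0] := leP 0 y.
- apply: (none (acos (x / r))); split.
    rewrite acos_lepi// andbT (lt_le_trans _ (acos_ge0 xr1))//.
    by rewrite oppr_lt0 pi_gt0.
  by rewrite cosa sina ger0_norm.
- apply: (none (- acos (x / r))); split; last first.
    by rewrite cosN sinN mulrN cosa sina ltr0_norm// opprK.
  rewrite ltrN2 (le_trans _ (pi_ge0 R)) ?oppr_le0 ?acos_ge0// andbT.
  apply: acos_ltpi; rewrite (andP xr1).2 andbT.
  rewrite lt_neqAle (andP xr1).1 andbT; apply/negP => /eqP xr.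
  have xE : x = - r by rewrite -rx -xr mulrN1.
  move: r2; rewrite xE sqrrN -[LHS]addr0 => /addrI/eqP.
  by rewrite eq_sym sqrf_eq0 lt_eqF.
Qed.

(* Partial derivatives in the real coordinates of [z = x + i y], taken on the
   real and imaginary parts of [f]. *)
Definition dx f z : R[i] :=
  derive1 (fun t : R => complex.Re (f (t +i* complex.Im z))) (complex.Re z) +i*
  derive1 (fun t : R => complex.Im (f (t +i* complex.Im z))) (complex.Re z).

Definition dy f z : R[i] :=
  derive1 (fun t : R => complex.Re (f (complex.Re z +i* t))) (complex.Im z) +i*
  derive1 (fun t : R => complex.Im (f (complex.Re z +i* t))) (complex.Im z).

Definition has_partials f z : Prop :=
  [/\ derivable (fun t : R => complex.Re (f (t +i* complex.Im z)))
                (complex.Re z) 1,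
      derivable (fun t : R => complex.Im (f (t +i* complex.Im z)))
                (complex.Re z) 1,
      derivable (fun t : R => complex.Re (f (complex.Re z +i* t)))
                (complex.Im z) 1 &
      derivable (fun t : R => complex.Im (f (complex.Re z +i* t)))
                (complex.Im z) 1].

Fixpoint continuously_differentiable (m : nat) f : Prop :=
  (forall z, disk z -> {for z, continuous f}) /\
  if m is m'.+1 then
    [/\ forall z, disk z -> has_partials f z,
        continuously_differentiable m' (dx f) &
        continuously_differentiable m' (dy f)]
  else True.

Definition dz f z : R[i] := (dx f z - 'i * dy f z) / 2%:R.
Definition dzbar f z : R[i] := (dx f z + 'i * dy f z) / 2%:R.

Definition Lambda f z : R := modulus (dz f z) + modulus (dzbar f z).
Definition lambda_min f z : R := `|modulus (dz f z) - modulus (dzbar f z)|.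
Definition jacobian_det f z : R := modulus (dz f z) ^+ 2 - modulus (dzbar f z) ^+ 2.

Definition laplacian f : R[i] -> R[i] := fun z => 4%:R * dz (dzbar f) z.

Definition polyharmonic (p : nat) f : Prop :=
  continuously_differentiable (2 * p) f /\
  forall z, disk z -> iter p laplacian f z = 0.

Definition absolutely_continuous (u v : R) (g : R -> R[i]) : Prop :=
  forall e : R, 0 < e -> exists2 d : R, 0 < d &
    forall (n : nat) (s t : 'I_n -> R),
      (forall i, [/\ u <= s i, s i <= t i & t i <= v]) ->
      (forall i j, i != j -> t i <= s j \/ t j <= s i) ->
      \sum_(i < n) (t i - s i) < d ->
      \sum_(i < n) modulus (g (t i) - g (s i)) < e.

Local Notation area := (@lebesgue_measure R \x @lebesgue_measure R)%E.

(* Integrability of the squared moduli over every closed rectangle in the disk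
   is the local L^2 condition, as such rectangles cover its compact subsets. *)
Definition ACL2 f : Prop :=
  forall x1 x2 y1 y2 : R, x1 < x2 -> y1 < y2 ->
    (forall x y, x1 <= x <= x2 -> y1 <= y <= y2 -> disk (x +i* y)) ->
    [/\ {ae @lebesgue_measure R, forall y : R, y1 <= y <= y2 ->
           absolutely_continuous x1 x2 (fun x => f (x +i* y))},
        {ae @lebesgue_measure R, forall x : R, x1 <= x <= x2 ->
           absolutely_continuous y1 y2 (fun y => f (x +i* y))},
        area.-integrable (`[x1, x2] `*` `[y1, y2])
          (fun w => (modulus (dx f (w.1 +i* w.2)) ^+ 2)%:E) &
        area.-integrable (`[x1, x2] `*` `[y1, y2])
          (fun w => (modulus (dy f (w.1 +i* w.2)) ^+ 2)%:E)].

(* The notion appropriate to continuously differentiable maps; together with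
   the nonvanishing of the Jacobian below it gives [0 < jacobian_det f] a.e. *)
Definition sense_preserving f : Prop := forall z, disk z -> 0 <= jacobian_det f z.

Definition quasiregular (K : R) f : Prop :=
  [/\ forall z, disk z -> {for z, continuous f},
      ACL2 f,
      sense_preserving f,
      {ae area, forall w : R * R,
         disk (w.1 +i* w.2) -> jacobian_det f (w.1 +i* w.2) != 0} &
      {ae area, forall w : R * R, disk (w.1 +i* w.2) ->
         Lambda f (w.1 +i* w.2) ^+ 2 <= K * jacobian_det f (w.1 +i* w.2)}].

(* The power series [\sum_(n >= 1) c n * z ^+ n] converges throughout the disk
   and its sum is complex differentiable there. *)
Definition analytic_series c : Prop :=
  forall z, disk z ->
    cvgn (fun N => \sum_(1 <= n < N) c n * z ^+ n) /\
    derivable (fun w : R[i] => \big[+%R/0]_(1 <= n <oo) (c n * w ^+ n)) z 1.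

End Definitions.

(* Main.v *)
Require Import Defs.
From mathcomp Require Import all_boot all_order all_algebra.
From mathcomp Require Import all_classical all_reals all_analysis.
From mathcomp Require Import cyclic separable cyclotomic ring lra zify.

Import Order.TTheory GRing.Theory Num.Theory numFieldNormedType.Exports.

Local Open Scope classical_set_scope.
Local Open Scope ring_scope.
Local Open Scope complex_scope.

Set Implicit Arguments.
Unset Strict Implicit.
Unset Printing Implicit Defensive.

(** The dilatation bound gives [Lambda <= K lambda_F], hence
[2 (|F_z|^2 + |F_zbar|^2) = Lambda^2 + lambda_F^2 <= (K^2 + 1) lambda^2].  On the
circle [|z| = r] the functions [z F_z] and [zbar F_zbar] are Fourier series; by
Bessel's inequality their coefficients of frequency [n] and [-n], which are
[sum_k (n+k-1) a_(n,k) r^(n+2(k-1))], [sum_k (k-1) a_(n,k) r^(n+2(k-1))] and the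
analogues for [b], have square sum at most [(K^2 + 1) lambda^2 / 2].  The condition
on the arguments says that the real parts of [a_(n,i) * conj a_(n,j)] are nonnegative,
so each of these sums dominates each of its terms in modulus.  Letting [r] tend to
[1] gives [(|a_(n,k)|^2 + |b_(n,k)|^2) ((n+k-1)^2 + (k-1)^2) <= (K^2 + 1) lambda^2 / 2].

No series is differentiated and no integral is taken: [F] minus a truncation of
its series is Lipschitz with a small constant, so the derivatives of [F] are close
to those of a polynomial in [z] and [zbar], and means over circles are replaced
by means over roots of unity. *)

(** * Moduli *)

Lemma modulusE (R : realType) (z : R[i]) :
  modulus z = Num.sqrt (complex.Re z ^+ 2 + complex.Im z ^+ 2).
Proof. by case: z. Qed.

Lemma sqr_modulus (R : realType) (z : R[i]) :
  modulus z ^+ 2 = complex.Re z ^+ 2 + complex.Im z ^+ 2.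
Proof. by rewrite modulusE sqr_sqrtr// addr_ge0 ?sqr_ge0. Qed.

Lemma mulC_conj (R : realType) (z : R[i]) : z * z^*%C = (modulus z ^+ 2)%:C.
Proof.
rewrite sqr_modulus; case: z => x y /=; apply/eqP.
by rewrite eq_complex /= mulrN opprK !expr2 eqxx/= mulrN [y * x]mulrC addNr.
Qed.

Lemma modulus_ge0 (R : realType) (z : R[i]) : 0 <= modulus z.
Proof. by rewrite modulusE sqrtr_ge0. Qed.

Lemma modulusM (R : realType) (z w : R[i]) :
  modulus (z * w) = modulus z * modulus w.
Proof. exact: Normc.normcM. Qed.

Lemma modulusD (R : realType) (z w : R[i]) :
  modulus (z + w) <= modulus z + modulus w.
Proof. exact: le_normcD. Qed.

Lemma modulusN (R : realType) (z : R[i]) : modulus (- z) = modulus z.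
Proof. exact: normcN. Qed.

Lemma modulus0 (R : realType) : modulus (0 : R[i]) = 0.
Proof. exact: Normc.normc0. Qed.

Lemma modulus1 (R : realType) : modulus (1 : R[i]) = 1.
Proof. exact: Normc.normc1. Qed.

Lemma modulusJ (R : realType) (z : R[i]) : modulus z^*%C = modulus z.
Proof. by rewrite !modulusE; case: z => x y /=; rewrite sqrrN. Qed.

Lemma modulusX (R : realType) (z : R[i]) n : modulus (z ^+ n) = modulus z ^+ n.
Proof.
by elim: n => [|n IHn]; rewrite ?expr0 ?modulus1// !exprS modulusM IHn.
Qed.

Lemma modulus_real (R : realType) (x : R) : modulus x%:C = `|x|.
Proof. by rewrite modulusE /= expr0n addr0 sqrtr_sqr. Qed.

Lemma modulus_sum (R : realType) (I : Type) (s : seq I) (P : pred I)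
    (f : I -> R[i]) :
  modulus (\sum_(i <- s | P i) f i) <= \sum_(i <- s | P i) modulus (f i).
Proof.
elim/big_rec2: _ => [|i y x _ yx]; first by rewrite modulus0.
by rewrite (le_trans (modulusD _ _))// lerD2l.
Qed.

Lemma Re_le_modulus (R : realType) (z : R[i]) : `|complex.Re z| <= modulus z.
Proof.
by rewrite modulusE -sqrtr_sqr ler_wsqrtr// lerDl sqr_ge0.
Qed.

Lemma Im_le_modulus (R : realType) (z : R[i]) : `|complex.Im z| <= modulus z.
Proof.
by rewrite modulusE -sqrtr_sqr ler_wsqrtr// lerDr sqr_ge0.
Qed.

Lemma modulus_le_ReIm (R : realType) (z : R[i]) :
  modulus z <= `|complex.Re z| + `|complex.Im z|.
Proof.
rewrite -(@ler_pXn2r _ 2%N)// ?nnegrE ?modulus_ge0 ?addr_ge0//.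
by rewrite sqr_modulus sqrrD !real_normK ?num_real// addrAC lerDl mulrn_wge0// mulr_ge0.
Qed.

(** * Bessel's inequality over roots of unity *)

(** Since [R[i]] is algebraically closed, ['X^N - 1] splits; it is separable in characteristic zero,
    so it has [N] distinct roots, among which one is primitive. *)
Lemma exists_prim_root (R : realType) (N : nat) : (0 < N)%N ->
  exists w : R[i], N.-primitive_root w.
Proof.
move=> N0; pose p : {poly R[i]} := 'X^N - 1.
have [r Dp] := closed_field_poly_normal p.
rewrite (monicP _) ?monicXnsubC // scale1r in Dp.
have rn1 : all N.-unity_root r by apply/allP=> z; rewrite -root_prod_XsubC -Dp.
have sz_r : (N < (size r).+1)%N.
  by rewrite -(size_prod_XsubC r id) -Dp size_XnsubC.
have [|z] := hasP (has_prim_root N0 rn1 _ sz_r); last by exists z.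
by rewrite -separable_prod_XsubC -Dp separable_Xn_sub_1 // pnatr_eq0 -lt0n.
Qed.

Lemma prim_root_sum (R : realType) (N d : nat) (w : R[i]) :
  N.-primitive_root w ->
  \sum_(j < N) (w ^+ j) ^+ d = if (N %| d)%N then N%:R else 0.
Proof.
move=> wN; have N0 := prim_order_gt0 wN.
under eq_bigr do rewrite exprAC.
case: ifPn => dN.
  have -> : w ^+ d = 1 by apply/eqP; rewrite -(prim_order_dvd wN).
  by under eq_bigr do rewrite expr1n; rewrite sumr_const card_ord.
have wd1 : w ^+ d - 1 != 0 by rewrite subr_eq0 -(prim_order_dvd wN).
apply: (mulfI wd1); rewrite mulr0 -subrX1 exprAC (prim_expr_order wN).
by rewrite expr1n subrr.
Qed.

Lemma modulus_prim_root (R : realType) (N j : nat) (w : R[i]) :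
  N.-primitive_root w -> modulus (w ^+ j) = 1.
Proof.
move=> wN; have N0 := prim_order_gt0 wN.
have : modulus (w ^+ j) ^+ N = 1.
  by rewrite -modulusX exprAC (prim_expr_order wN) expr1n modulus1.
by move=> /eqP; rewrite pexpr_eq1 ?modulus_ge0// => /eqP.
Qed.

(** On the unit circle conjugation is inversion; adding [N] to the exponent [- n] keeps it a natural
    number. *)
Lemma prim_root_conj (R : realType) (N j n : nat) (w : R[i]) :
  N.-primitive_root w -> (n <= N)%N ->
  ((w ^+ j) ^+ n)^*%C = (w ^+ j) ^+ (N - n).
Proof.
move=> wN nN; have wj0 : (w ^+ j) ^+ n != 0.
  apply/eqP => /(congr1 (@modulus R)) /eqP.
  by rewrite modulusX (modulus_prim_root _ wN) expr1n modulus0 oner_eq0.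
apply: (mulfI wj0); rewrite mulC_conj modulusX (modulus_prim_root _ wN).
by rewrite -exprD subnKC// [w ^+ j ^+ N]exprAC (prim_expr_order wN) !expr1n.
Qed.

(** On the unit circle [be i] is the coefficient of frequency [- i]; there is no constant term. *)
Definition trig_poly (R : realType) (m : nat) (al be : nat -> R[i]) (z : R[i]) :=
  \sum_(1 <= i < m) (al i * z ^+ i + be i * (z ^+ i)^*%C).

(** With [2m] nodes the frequencies strictly between [-m] and [m] do not alias: [i + (2m - n)] lies
    strictly between [0] and [4m], so [2m] divides it only if [i = n]. *)
Lemma prim_root_orthogonal (R : realType) (m i n : nat) (w : R[i]) :
  (m.*2).-primitive_root w -> (1 <= i < m)%N -> (1 <= n < m)%N ->
  \sum_(j < m.*2) (w ^+ j) ^+ i * ((w ^+ j) ^+ n)^*%C =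
    if i == n then m.*2%:R else 0.
Proof.
move=> wN im nm.
have nN : (n <= m.*2)%N by lia.
under eq_bigr do rewrite (prim_root_conj _ wN nN) -exprD.
rewrite (prim_root_sum _ wN); case: eqP => [->|/eqP ine].
  by rewrite subnKC ?dvdnn//; lia.
rewrite ifF//; apply/negP => /dvdnP[[|[|q]]]; rewrite ?mulSn; move/eqP: ine; lia.
Qed.

Lemma prim_root_orthogonal0 (R : realType) (m i n : nat) (w : R[i]) :
  (m.*2).-primitive_root w -> (1 <= i < m)%N -> (1 <= n < m)%N ->
  \sum_(j < m.*2) (w ^+ j) ^+ i * (w ^+ j) ^+ n = 0.
Proof.
move=> wN im nm.
under eq_bigr do rewrite -?exprD.
rewrite (prim_root_sum _ wN) ifF//; apply/negP => /dvdnP[[|q]]; rewrite ?mulSn; lia.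
Qed.

Lemma trig_poly_coefp (R : realType) (m n : nat) (w : R[i]) al be :
  (m.*2).-primitive_root w -> (1 <= n < m)%N ->
  \sum_(j < m.*2) trig_poly m al be (w ^+ j) * ((w ^+ j) ^+ n)^*%C =
    m.*2%:R * al n.
Proof.
move=> wN nm; under eq_bigr do rewrite mulr_suml.
rewrite exchange_big /= (bigD1_seq n) ?iota_uniq ?mem_index_iota//=.
rewrite [X in _ + X]big_nat_cond [X in _ + X]big1 ?addr0.
  under eq_bigr do rewrite mulrDl -!mulrA -rmorphM.
  rewrite big_split /= -!mulr_sumr -rmorph_sum/=.
  by rewrite prim_root_orthogonal// eqxx prim_root_orthogonal0// conjc0 mulr0 addr0 mulrC.
move=> i /andP[im ine]; under eq_bigr do rewrite mulrDl -!mulrA -rmorphM.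
rewrite big_split /= -!mulr_sumr -rmorph_sum/=.
by rewrite prim_root_orthogonal// (negbTE ine) prim_root_orthogonal0// conjc0 !mulr0 addr0.
Qed.

Lemma trig_poly_conj (R : realType) (m : nat) (al be : nat -> R[i]) z :
  (trig_poly m al be z)^*%C =
  trig_poly m (fun i => (be i)^*%C) (fun i => (al i)^*%C) z.
Proof.
rewrite /trig_poly rmorph_sum /=; apply: eq_bigr => i _.
by rewrite rmorphD !rmorphM/= conjcK addrC.
Qed.

(** Conjugation exchanges the two coefficient families, which reduces this to [trig_poly_coefp]. *)
Lemma trig_poly_coefm (R : realType) (m n : nat) (w : R[i]) al be :
  (m.*2).-primitive_root w -> (1 <= n < m)%N ->
  \sum_(j < m.*2) trig_poly m al be (w ^+ j) * (w ^+ j) ^+ n =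
    m.*2%:R * be n.
Proof.
move=> wN nm; apply: (can_inj (@conjcK _)).
rewrite rmorph_sum rmorphM /= conjc_nat.
rewrite -(trig_poly_coefp (fun i => (be i)^*%C) (fun i => (al i)^*%C) wN nm).
by apply: eq_bigr => j _; rewrite rmorphM /= trig_poly_conj.
Qed.

(** The function [h] is the orthogonal projection of [g] onto the frequencies [n] and [-n];
    expanding the nonnegative sum of [|g - h|^2] over the nodes gives the inequality. *)
Lemma trig_poly_bessel (R : realType) (m n : nat) (w : R[i]) al be :
  (m.*2).-primitive_root w -> (1 <= n < m)%N ->
  m.*2%:R * (modulus (al n) ^+ 2 + modulus (be n) ^+ 2) <=
  \sum_(j < m.*2) modulus (trig_poly m al be (w ^+ j)) ^+ 2.
Proof.
move=> wN nm.
(* These coefficients present [h] as a [trig_poly], so that [dot] also computes the product of [h]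
   with itself. *)
pose al' (i : nat) := if i == n then al n else 0.
pose be' (i : nat) := if i == n then be n else 0.
pose h z := al n * z ^+ n + be n * (z ^+ n)^*%C.
have hE z : h z = trig_poly m al' be' z.
  rewrite /trig_poly (bigD1_seq n) ?iota_uniq ?mem_index_iota//=.
  rewrite /al' /be' eqxx big1 ?addr0// => i /negbTE ->.
  by rewrite !mul0r addr0.
have dot u v : \sum_(j < m.*2) trig_poly m u v (w ^+ j) * (h (w ^+ j))^*%C =
    m.*2%:R * (u n * (al n)^*%C + v n * (be n)^*%C).
  under eq_bigr do rewrite rmorphD !rmorphM /= conjcK mulrDr mulrCA
    [_ * (_ * _ ^+ _)]mulrCA.
  rewrite big_split /= -!mulr_sumr (trig_poly_coefp _ _ wN nm).
  rewrite (trig_poly_coefm _ _ wN nm); ring.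
have dotg := dot al be.
have doth : \sum_(j < m.*2) h (w ^+ j) * (h (w ^+ j))^*%C =
    m.*2%:R * (al n * (al n)^*%C + be n * (be n)^*%C).
  under eq_bigr do rewrite {1}hE.
  by rewrite dot /al' /be' eqxx.
set g := trig_poly m al be in dotg *.
set c := al n * _ + _ in dotg doth.
have cE : c = (modulus (al n) ^+ 2 + modulus (be n) ^+ 2)%:C.
  by rewrite /c !mulC_conj rmorphD.
rewrite -lecR rmorph_sum /= -subr_ge0.
have -> : (m.*2%:R * (modulus (al n) ^+ 2 + modulus (be n) ^+ 2))%:C = m.*2%:R * c.
  by rewrite cE rmorphM rmorph_nat.
suff -> : \sum_(j < m.*2) ((modulus (g (w ^+ j)) ^+ 2)%:C) - m.*2%:R * c =
    \sum_(j < m.*2) (g (w ^+ j) - h (w ^+ j)) * (g (w ^+ j) - h (w ^+ j))^*%C.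
  by apply: sumr_ge0 => j _; rewrite mulC_conj ler0c sqr_ge0.
(* As [c] is real, the two cross terms are equal, and one of them cancels the square of [h]. *)
have dotgJ : \sum_(j < m.*2) h (w ^+ j) * (g (w ^+ j))^*%C = m.*2%:R * c.
  apply: (can_inj (@conjcK _)); rewrite rmorph_sum /=.
  under eq_bigr do rewrite rmorphM /= conjcK mulrC.
  by rewrite dotg rmorphM /= conjc_nat cE conjc_real.
under [RHS]eq_bigr do rewrite rmorphB mulrBl !mulrBr /=.
rewrite !sumrB dotg doth dotgJ subrr subr0.
by under [in RHS]eq_bigr do rewrite mulC_conj.
Qed.

(** * Wirtinger derivatives *)

(** The velocity is taken on real and imaginary parts separately, in agreement with [dx] and
    [dy]. *)
Definition curve_derive (R : realType) (g : R -> R[i]) (t : R) (v : R[i]) : Prop :=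
  is_derive t 1 (fun s => complex.Re (g s)) (complex.Re v) /\
  is_derive t 1 (fun s => complex.Im (g s)) (complex.Im v).

(* [P] and [Q] play the roles of the values at [z] of the derivatives
   [f_z] and [f_zbar]: the chain rule along curves is the definition. *)
Definition wirtinger (R : realType) (f : R[i] -> R[i]) (z P Q : R[i]) : Prop :=
  forall (g : R -> R[i]) (t : R) (v : R[i]), g t = z -> curve_derive g t v ->
    curve_derive (f \o g) t (P * v + Q * v^*%C).

Lemma curve_derive_eq (R : realType) (g : R -> R[i]) t v v' :
  curve_derive g t v -> v = v' -> curve_derive g t v'.
Proof. by move=> ? <-. Qed.

Lemma curve_derive_cst (R : realType) (c : R[i]) (t : R) :
  curve_derive (fun=> c) t 0.
Proof. by split; exact: is_derive_cst. Qed.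

Lemma curve_deriveD (R : realType) (f g : R -> R[i]) t v w :
  curve_derive f t v -> curve_derive g t w ->
  curve_derive (fun s => f s + g s) t (v + w).
Proof.
move=> [f1 f2] [g1 g2]; split.
- rewrite (_ : (fun s => _) =
      (fun s => complex.Re (f s)) + (fun s => complex.Re (g s))).
    by rewrite raddfD; exact: is_deriveD.
  by apply/funext => s; rewrite raddfD.
- rewrite (_ : (fun s => _) =
      (fun s => complex.Im (f s)) + (fun s => complex.Im (g s))).
    by rewrite raddfD; exact: is_deriveD.
  by apply/funext => s; rewrite raddfD.
Qed.

Lemma curve_deriveM (R : realType) (f g : R -> R[i]) t v w :
  curve_derive f t v -> curve_derive g t w ->
  curve_derive (fun s => f s * g s) t (f t * w + g t * v).
Proof.
move=> [f1 f2] [g1 g2]; split.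
- rewrite (_ : (fun s => _) =
      (fun s => complex.Re (f s)) * (fun s => complex.Re (g s)) -
      (fun s => complex.Im (f s)) * (fun s => complex.Im (g s))); last first.
    by apply/funext => s; rewrite !fctE; case: (f s) => ? ?; case: (g s).
  apply: is_derive_eq (is_deriveB (is_deriveM f1 g1) (is_deriveM f2 g2)) _.
  case: (f t) => ? ?; case: (g t) => ? ?.
  by case: v {f1 f2} => ? ?; case: w {g1 g2} => ? ? /=; rewrite /GRing.scale/=; ring.
- rewrite (_ : (fun s => _) =
      (fun s => complex.Re (f s)) * (fun s => complex.Im (g s)) +
      (fun s => complex.Im (f s)) * (fun s => complex.Re (g s))); last first.
    by apply/funext => s; rewrite !fctE; case: (f s) => ? ?; case: (g s).
  apply: is_derive_eq (is_deriveD (is_deriveM f1 g2) (is_deriveM f2 g1)) _.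
  case: (f t) => ? ?; case: (g t) => ? ?.
  by case: v {f1 f2} => ? ?; case: w {g1 g2} => ? ? /=; rewrite /GRing.scale/=; ring.
Qed.

Lemma curve_deriveJ (R : realType) (f : R -> R[i]) t v :
  curve_derive f t v -> curve_derive (fun s => (f s)^*%C) t v^*%C.
Proof.
move=> [f1 f2]; split.
- rewrite (_ : (fun s => _) = (fun s => complex.Re (f s))).
    by case: v f1 f2.
  by apply/funext => s; case: (f s).
- rewrite (_ : (fun s => _) = - (fun s => complex.Im (f s))).
    by case: v f1 f2 => ? ? /= ? ?; exact: is_deriveN.
  by apply/funext => s; rewrite /GRing.opp /=; case: (f s).
Qed.

Lemma curve_deriveN (R : realType) (f : R -> R[i]) t v :
  curve_derive f t v -> curve_derive (fun s => - f s) t (- v).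
Proof.
move=> fv; have := curve_deriveM (curve_derive_cst (-1) t) fv.
under eq_fun do rewrite mulN1r.
by move/curve_derive_eq; apply; rewrite mulr0 addr0 mulN1r.
Qed.

Lemma wirtinger_eq (R : realType) (f : R[i] -> R[i]) z P Q P' Q' :
  wirtinger f z P Q -> P = P' -> Q = Q' -> wirtinger f z P' Q'.
Proof. by move=> ? <- <-. Qed.

Lemma wirtinger_cst (R : realType) (c z : R[i]) : wirtinger (fun=> c) z 0 0.
Proof.
by move=> g t v _ _; rewrite !mul0r addr0; exact: curve_derive_cst.
Qed.

Lemma wirtinger_id (R : realType) (z : R[i]) : wirtinger id z 1 0.
Proof. by move=> g t v _ gv; rewrite mul1r mul0r addr0. Qed.

Lemma wirtingerD (R : realType) (f g : R[i] -> R[i]) z P Q P' Q' :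
  wirtinger f z P Q -> wirtinger g z P' Q' ->
  wirtinger (fun w => f w + g w) z (P + P') (Q + Q').
Proof.
move=> fz gz h t v hz hv.
apply: curve_derive_eq (curve_deriveD (fz h t v hz hv) (gz h t v hz hv)) _; ring.
Qed.

Lemma wirtingerM (R : realType) (f g : R[i] -> R[i]) z P Q P' Q' :
  wirtinger f z P Q -> wirtinger g z P' Q' ->
  wirtinger (fun w => f w * g w) z (f z * P' + g z * P) (f z * Q' + g z * Q).
Proof.
move=> fz gz h t v hz hv.
apply: curve_derive_eq (curve_deriveM (fz h t v hz hv) (gz h t v hz hv)) _.
by rewrite /= hz; ring.
Qed.

Lemma wirtingerJ (R : realType) (f : R[i] -> R[i]) z P Q :
  wirtinger f z P Q -> wirtinger (fun w => (f w)^*%C) z Q^*%C P^*%C.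
Proof.
move=> fz h t v hz hv.
apply: curve_derive_eq (curve_deriveJ (fz h t v hz hv)) _.
by rewrite rmorphD !rmorphM/= conjcK addrC.
Qed.

(** For [n = 0] the truncated exponent [n.-1] is harmless, since the factor [n%:R] vanishes. *)
Lemma wirtingerX (R : realType) (f : R[i] -> R[i]) n z P Q :
  wirtinger f z P Q ->
  wirtinger (fun w => f w ^+ n) z (n%:R * f z ^+ n.-1 * P) (n%:R * f z ^+ n.-1 * Q).
Proof.
move=> fz; elim: n => [|n IHn].
  by rewrite !mul0r; under [X in wirtinger X]eq_fun do rewrite expr0; exact: wirtinger_cst.
under [X in wirtinger X]eq_fun do rewrite exprS.
apply: wirtinger_eq (wirtingerM fz IHn) _ _ => /=; case: n {IHn} => [|n] /=;
  rewrite ?exprS ?expr0 -?natr1; ring.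
Qed.

Lemma wirtinger_sum (R : realType) (s : seq nat) (f : nat -> R[i] -> R[i]) z P Q :
  (forall i, i \in s -> wirtinger (f i) z (P i) (Q i)) ->
  wirtinger (fun w => \sum_(i <- s) f i w) z (\sum_(i <- s) P i) (\sum_(i <- s) Q i).
Proof.
elim: s => [|i s IHs] fs.
  by under [X in wirtinger X]eq_fun do rewrite big_nil; rewrite !big_nil; exact: wirtinger_cst.
under [X in wirtinger X]eq_fun do rewrite big_cons.
rewrite !big_cons; apply: wirtingerD; first by apply: fs; rewrite mem_head.
by apply: IHs => j js; apply: fs; rewrite in_cons js orbT.
Qed.

Lemma curve_derive_line (R : realType) (z : R[i]) :
  curve_derive (fun s => s +i* complex.Im z) (complex.Re z) 1 /\
  curve_derive (fun s => complex.Re z +i* s) (complex.Im z) 'i.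
Proof. by split; split; (exact: is_derive_cst || exact: is_derive_id). Qed.

Lemma has_partials_derive (R : realType) (f : R[i] -> R[i]) z : has_partials f z ->
  curve_derive (fun s => f (s +i* complex.Im z)) (complex.Re z) (dx f z) /\
  curve_derive (fun s => f (complex.Re z +i* s)) (complex.Im z) (dy f z).
Proof.
by case=> ? ? ? ?; split; split; rewrite /dx /dy /= derive1E; exact: derivableP.
Qed.

(** Near [t] the difference quotients are bounded by [L], and some of them are arbitrarily close to
    [d]. *)
Lemma is_derive_lipschitz (R : realType) (f : R -> R) t d L e : 0 < e ->
  (forall s, `|s - t| < e -> `|f s - f t| <= L * `|s - t|) ->
  is_derive t 1 f d -> `|d| <= L.
Proof.
move=> e0 fL [fd <-]; apply/ler_addgt0Pr => e' e'0.
have fq := fd; move: fq; rewrite /derivable => /cvgrPdist_lt/(_ _ e'0) near_d.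
suff near_L : \forall h \near (0 : R)^',
    `|h^-1 *: ((f \o shift t) (h *: 1) - f t)| <= L.
  have [h [hd hL]] := filter_ex (filterI near_d near_L).
  rewrite -[X in `|X|](subrK (h^-1 *: ((f \o shift t) (h *: 1) - f t))).
  by rewrite (le_trans (ler_normD _ _))// addrC lerD// ltW.
near=> h.
have h0 : h != 0 by near: h; exact: nbhs_dnbhs_neq.
have he : `|h| < e.
  near: h; apply: dnbhs0_lt => //.
rewrite /= /GRing.scale /= mulr1 normrM normfV mulrC ler_pdivrMr ?normr_gt0//.
have := fL (h + t); rewrite addrK; exact.
Unshelve. all: by end_near. Qed.

(** The factor [2] comes from bounding the modulus by the sum of the absolute values of the two
    parts. *)
Lemma curve_derive_lipschitz (R : realType) (g : R -> R[i]) t v L e : 0 < e ->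
  (forall s, `|s - t| < e -> modulus (g s - g t) <= L * `|s - t|) ->
  curve_derive g t v -> modulus v <= 2%:R * L.
Proof.
move=> e0 gL [g1 g2]; rewrite (le_trans (modulus_le_ReIm v))// mulr_natl mulr2n.
rewrite lerD//.
- apply: (is_derive_lipschitz e0 _ g1) => s se; apply: le_trans (gL s se).
  by rewrite -raddfB Re_le_modulus.
- apply: (is_derive_lipschitz e0 _ g2) => s se; apply: le_trans (gL s se).
  by rewrite -raddfB Im_le_modulus.
Qed.

(** This replaces differentiation of the series: if [f - q] is Lipschitz at [z] with a small
    constant, the derivatives of [f] are close to those of [q]. The two coordinate lines control
    [dx f - (P + Q)] and [dy f - 'i * (P - Q)], and the two differences sought are half sums of
    these up to unit factors. *)
Lemma wirtinger_approx (R : realType) (f q : R[i] -> R[i]) z P Q L e : 0 < e ->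
  has_partials f z -> wirtinger q z P Q ->
  (forall w, modulus (w - z) < e ->
    modulus (f w - q w - (f z - q z)) <= L * modulus (w - z)) ->
  modulus (dz f z - P) <= 2%:R * L /\ modulus (dzbar f z - Q) <= 2%:R * L.
Proof.
move=> e0 /has_partials_derive[fx fy] qz fqL.
case: z fx fy qz fqL => x y /= fx fy qz fqL.
have [lx ly] := @curve_derive_line R (x +i* y).
have qx := qz _ _ _ erefl lx; have qy := qz _ _ _ erefl ly.
have fqx := curve_deriveD fx (curve_deriveN qx).
have fqy := curve_deriveD fy (curve_deriveN qy).
have dxL : modulus (dx f (x +i* y) - (P + Q)) <= 2%:R * L.
  have -> : P + Q = P * 1 + Q * 1^*%C by rewrite conjc1 !mulr1.
  apply: (curve_derive_lipschitz e0 _ fqx) => s se /=.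
  have sx : s +i* y - (x +i* y) = (s - x)%:C.
    by apply/eqP; rewrite eq_complex /= eqxx subrr eqxx.
  by have := fqL (s +i* y); rewrite sx modulus_real; exact.
have dyL : modulus (dy f (x +i* y) - 'i * (P - Q)) <= 2%:R * L.
  have -> : 'i * (P - Q) = P * 'i + Q * 'i^*%C.
    have -> : 'i^*%C = - 'i :> R[i] by apply/eqP; rewrite eq_complex /= oppr0 !eqxx.
    by ring.
  apply: (curve_derive_lipschitz e0 _ fqy) => s se /=.
  have sy : x +i* s - (x +i* y) = 'i * (s - y)%:C.
    by apply/eqP; rewrite eq_complex /=; apply/andP; split; apply/eqP; ring.
  have := fqL (x +i* s); rewrite sy modulusM modulus_real.
  have -> : modulus ('i : R[i]) = 1 by rewrite modulusE /= expr0n add0r expr1n sqrtr1.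
  rewrite mul1r; exact.
have half (A B : R[i]) : modulus A <= 2%:R * L -> modulus B <= 2%:R * L ->
    modulus ((A + B) / 2%:R) <= 2%:R * L.
  move=> AL BL; rewrite modulusM.
  have -> : modulus (2%:R^-1 : R[i]) = 2%:R^-1.
    have -> : 2%:R^-1 = (2%:R^-1 : R)%:C by rewrite fmorphV rmorph_nat.
    by rewrite modulus_real ger0_norm.
  have := modulusD A B; lra.
have i2 : 'i * 'i = -1 :> R[i] by rewrite -expr2 sqr_i.
have modi (A : R[i]) : modulus ('i * A) = modulus A.
  rewrite modulusM modulusE /= expr0n add0r expr1n sqrtr1 mul1r//.
have two0 : 2%:R != 0 :> R[i] by rewrite pnatr_eq0.
split.
- have -> : dz f (x +i* y) - P =
    ((dx f (x +i* y) - (P + Q)) + - ('i * (dy f (x +i* y) - 'i * (P - Q)))) / 2%:R.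
    rewrite mulrBr mulrA i2 /dz; apply: (mulIf two0).
    by rewrite mulrBl !divfK//; ring.
  by apply: half; rewrite // modulusN modi.
- have -> : dzbar f (x +i* y) - Q =
    ((dx f (x +i* y) - (P + Q)) + ('i * (dy f (x +i* y) - 'i * (P - Q)))) / 2%:R.
    rewrite mulrBr mulrA i2 /dzbar; apply: (mulIf two0).
    by rewrite mulrBl !divfK//; ring.
  by apply: half; rewrite // modi.
Qed.

(** * Lipschitz estimates for the series *)

(** This is [|z|^(2l) z^n], written as a monomial in [z] and its conjugate to make its Wirtinger
    derivatives explicit. *)
Definition zzbar_mono (R : realType) (n l : nat) (z : R[i]) : R[i] :=
  z ^+ (n + l) * (z^*%C) ^+ l.

Definition zzbar_term (R : realType) (a b : R[i]) (n l : nat) (z : R[i]) : R[i] :=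
  a * zzbar_mono n l z + (b * zzbar_mono n l z)^*%C.

(* The factor [rho] on the left avoids the truncated exponent [n.-1]. *)
Lemma expr_lipschitz (R : realType) (n : nat) (z w : R[i]) (rho : R) :
  modulus z <= rho -> modulus w <= rho ->
  rho * modulus (z ^+ n - w ^+ n) <= n%:R * rho ^+ n * modulus (z - w).
Proof.
move=> zr wr; have r0 : 0 <= rho := le_trans (modulus_ge0 z) zr.
elim: n => [|n IHn]; first by rewrite subrr modulus0 mulr0 !mul0r.
have -> : z ^+ n.+1 - w ^+ n.+1 = z * (z ^+ n - w ^+ n) + (z - w) * w ^+ n.
  by rewrite !exprS; ring.
have wn : modulus (w ^+ n) <= rho ^+ n.
  by rewrite modulusX lerXn2r ?nnegrE ?modulus_ge0.
apply: le_trans (ler_wpM2l r0 (modulusD _ _)) _; rewrite !modulusM mulrDr.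
have h1 : rho * (modulus z * modulus (z ^+ n - w ^+ n)) <=
    rho * (n%:R * rho ^+ n * modulus (z - w)).
  by rewrite mulrCA; apply: ler_pM; rewrite ?mulr_ge0 ?modulus_ge0.
have h2 : rho * (modulus (z - w) * modulus (w ^+ n)) <=
    rho * (modulus (z - w) * rho ^+ n).
  by rewrite !ler_wpM2l ?modulus_ge0.
apply: le_trans (lerD h1 h2) _.
by rewrite le_eqVlt -natr1 exprS; apply/orP; left; apply/eqP; ring.
Qed.

(** Splitting the difference as in the product rule gives the factor [n + 2l] and the power [n + 2l]
    of [rho]; as [1 <= n] and [rho <= 1], these are at most [(2l + 1) n] and [rho ^+ n], so [l]
    enters through a constant factor. *)
Lemma zzbar_mono_lipschitz (R : realType) (n l : nat) (z w : R[i]) (rho : R) :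
  modulus z <= rho -> modulus w <= rho -> rho <= 1 -> (1 <= n)%N ->
  rho * modulus (zzbar_mono n l z - zzbar_mono n l w) <=
    (l.*2.+1)%:R * (n%:R * rho ^+ n) * modulus (z - w).
Proof.
move=> zr wr r1 n1; have r0 : 0 <= rho := le_trans (modulus_ge0 z) zr.
have -> : zzbar_mono n l z - zzbar_mono n l w =
    z ^+ (n + l) * (z ^+ l - w ^+ l)^*%C + (z ^+ (n + l) - w ^+ (n + l)) * (w ^+ l)^*%C.
  by rewrite /zzbar_mono rmorphB !rmorphXn /=; ring.
have expr_le i (x : R[i]) : modulus x <= rho -> modulus (x ^+ i) <= rho ^+ i.
  by move=> xr; rewrite modulusX lerXn2r ?nnegrE ?modulus_ge0.
apply: le_trans (ler_wpM2l r0 (modulusD _ _)) _.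
rewrite !modulusM !modulusJ mulrDr.
have h1 : rho * (modulus (z ^+ (n + l)) * modulus (z ^+ l - w ^+ l)) <=
    rho ^+ (n + l) * (l%:R * rho ^+ l * modulus (z - w)).
  rewrite mulrCA; apply: ler_pM (expr_le _ _ zr) (expr_lipschitz _ zr wr);
    by rewrite ?mulr_ge0 ?modulus_ge0.
have h2 : rho * (modulus (z ^+ (n + l) - w ^+ (n + l)) * modulus (w ^+ l)) <=
    (n + l)%:R * rho ^+ (n + l) * modulus (z - w) * rho ^+ l.
  rewrite mulrA; apply: ler_pM (expr_lipschitz _ zr wr) (expr_le _ _ wr);
    by rewrite ?mulr_ge0 ?modulus_ge0.
apply: le_trans (lerD h1 h2) _.
have -> : rho ^+ (n + l) * (l%:R * rho ^+ l * modulus (z - w)) +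
    (n + l)%:R * rho ^+ (n + l) * modulus (z - w) * rho ^+ l =
    (n + l.*2)%:R * (rho ^+ n * (rho ^+ l * rho ^+ l)) * modulus (z - w).
  by rewrite -addnn !natrD exprD; ring.
rewrite ler_wpM2r ?modulus_ge0// [leRHS]mulrA ler_pM//.
- by rewrite !mulr_ge0 ?exprn_ge0.
- by rewrite -natrM ler_nat; nia.
- by rewrite ler_piMr ?exprn_ge0// mulr_ile1 ?exprn_ge0 ?exprn_ile1.
Qed.

Lemma zzbar_term_lipschitz (R : realType) (a b : R[i]) (n l : nat) (z w : R[i]) (rho : R) :
  modulus z <= rho -> modulus w <= rho -> rho <= 1 -> (1 <= n)%N ->
  rho * modulus (zzbar_term a b n l z - zzbar_term a b n l w) <=
    (modulus a + modulus b) * (l.*2.+1)%:R * (n%:R * rho ^+ n) * modulus (z - w).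
Proof.
move=> zr wr r1 n1; have r0 : 0 <= rho := le_trans (modulus_ge0 z) zr.
have -> : zzbar_term a b n l z - zzbar_term a b n l w =
    a * (zzbar_mono n l z - zzbar_mono n l w) +
    (b * (zzbar_mono n l z - zzbar_mono n l w))^*%C.
  by rewrite /zzbar_term !mulrBr rmorphB /=; ring.
apply: le_trans (ler_wpM2l r0 (modulusD _ _)) _.
rewrite modulusJ !modulusM -mulrDl mulrCA -!mulrA ler_wpM2l ?addr_ge0 ?modulus_ge0//.
by rewrite !mulrA -(mulrA _ n%:R) zzbar_mono_lipschitz.
Qed.

Lemma geometric_tail (R : realType) (s : R) (m N : nat) : 0 < s < 1 ->
  (m <= N)%N -> (1 - s) * \sum_(m <= n < N) s ^+ n <= s ^+ m.
Proof.
move=> /andP[s0 s1] mN.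
have -> : (1 - s) * \sum_(m <= n < N) s ^+ n = s ^+ m - s ^+ N.
  rewrite mulr_sumr -[RHS]opprB -telescope_sumr// -sumrN.
  by apply: eq_bigr => n _; rewrite exprS; ring.
by rewrite gerBl exprn_ge0 ?ltW.
Qed.

Lemma natr_expr_le (R : realType) (s : R) (n : nat) : 0 < s < 1 ->
  (1 - s) * (n%:R * s ^+ n) <= 1.
Proof.
(* The induction carries the stronger form [n s^n <= 1 + s + ... + s^(n-1)], multiplied by
   [1 - s]. *)
move=> /andP[s0 s1]; suff : (1 - s) * (n%:R * s ^+ n) <= 1 - s ^+ n.
  by move/le_trans; apply; rewrite gerBl exprn_ge0 ?ltW.
elim: n => [|n IHn]; first by rewrite mul0r mulr0 expr0 subrr.
have sn : 0 <= s ^+ n <= 1 by rewrite exprn_ge0 ?exprn_ile1 ?ltW.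
rewrite -natr1 exprS; move: (s ^+ n) (n%:R : R) sn IHn => t k /andP[t0 t1] IHn.
have h1 := ler_wpM2l (ltW s0) IHn.
have : 0 <= (1 - s) * (1 - s * t).
  by rewrite mulr_ge0 ?subr_ge0 ?(ltW s1)// mulr_ile1 ?(ltW s0) ?(ltW s1).
by move: h1; lra.
Qed.

(** The radius [s ^+ 3] provides three factors [s ^+ n]: the first absorbs the coefficients, the
    second the factor [n] of the Lipschitz constant, and the third is summed as a geometric tail. *)
Lemma zzbar_term_tail (R : realType) (a b : nat -> R[i]) (l m N : nat)
    (z w : R[i]) (s C : R) :
  0 < s < 1 -> (forall n, (1 <= n)%N -> (modulus (a n) + modulus (b n)) * s ^+ n <= C) ->
  modulus z <= s ^+ 3 -> modulus w <= s ^+ 3 -> (1 <= m <= N)%N ->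
  modulus (\sum_(m <= n < N) (zzbar_term (a n) (b n) n l z -
                              zzbar_term (a n) (b n) n l w)) <=
  C * (l.*2.+1)%:R / ((1 - s) ^+ 2 * s ^+ 3) * s ^+ m * modulus (z - w).
Proof.
move=> s01 abC zs ws /andP[m1 mN]; have /andP[s0 s1] := s01.
have C0 : 0 <= C.
  by rewrite (le_trans _ (abC 1%N _))// mulr_ge0 ?addr_ge0 ?modulus_ge0// exprn_ge0 ?ltW.
have s3 : 0 < s ^+ 3 by rewrite exprn_gt0.
have s3le : s ^+ 3 <= 1 by rewrite exprn_ile1 ?ltW.
have s1' : 0 < 1 - s by rewrite subr_gt0.
set D := modulus (z - w); have D0 : 0 <= D := modulus_ge0 _.
have term n : (1 <= n)%N ->
    modulus (zzbar_term (a n) (b n) n l z - zzbar_term (a n) (b n) n l w) <=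
    C * (l.*2.+1)%:R / ((1 - s) * s ^+ 3) * D * s ^+ n.
  move=> n1; have := zzbar_term_lipschitz (a n) (b n) l zs ws s3le n1.
  rewrite -/D => T; rewrite -(ler_pM2l s3); apply: le_trans T _.
  have -> : s ^+ 3 * (C * (l.*2.+1)%:R / ((1 - s) * s ^+ 3) * D * s ^+ n) =
      C * (1 - s)^-1 * s ^+ n * ((l.*2.+1)%:R * D).
    by field; rewrite !gt_eqF.
  have -> : (modulus (a n) + modulus (b n)) * (l.*2.+1)%:R * (n%:R * (s ^+ 3) ^+ n) * D =
      ((modulus (a n) + modulus (b n)) * s ^+ n) * (n%:R * s ^+ n) * s ^+ n *
      ((l.*2.+1)%:R * D).
    by rewrite -exprM mulnC exprM !exprS; ring.
  have sn0 : 0 <= s ^+ n by rewrite exprn_ge0 ?ltW.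
  rewrite ler_wpM2r ?mulr_ge0// ler_wpM2r//.
  apply: ler_pM; rewrite ?mulr_ge0 ?addr_ge0 ?modulus_ge0 ?abC//.
  by rewrite -(ler_pM2l s1') divff ?gt_eqF// natr_expr_le.
apply: le_trans (modulus_sum _ _ _) _.
apply: (@le_trans _ _ (\sum_(m <= n < N) C * (l.*2.+1)%:R / ((1 - s) * s ^+ 3) * D * s ^+ n)).
  by apply: ler_sum_nat => n /andP[mn _]; apply: term; exact: leq_trans mn.
rewrite -mulr_sumr -(ler_pM2l s1').
have -> : (1 - s) * (C * (l.*2.+1)%:R / ((1 - s) ^+ 2 * s ^+ 3) * s ^+ m * D) =
   C * (l.*2.+1)%:R / ((1 - s) * s ^+ 3) * D * s ^+ m.
  by field; rewrite !gt_eqF.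
rewrite mulrCA ler_wpM2l ?geometric_tail// !mulr_ge0// invr_ge0 mulr_ge0 ?ltW//.
Qed.

(** The series converges at [s]. Beyond some [N] the partial sums are within [1] of the limit, so
    each term, a difference of consecutive ones, is below [2]; the earlier terms are bounded by
    their sum. *)
Lemma analytic_series_bound (R : realType) (c : nat -> R[i]) (s : R) :
  analytic_series c -> 0 < s < 1 ->
  exists C : R, forall n, (1 <= n)%N -> modulus (c n) * s ^+ n <= C.
Proof.
move=> ca /andP[s0 s1].
have sE : modulus (s%:C) = s by rewrite modulus_real gtr0_norm.
have [|/cvg_ex[l /= cl] _] := ca s%:C; first by rewrite /disk /mkset sE.
have := cl; move/cvgrPdist_lt => /(_ 1 ltr01)[N _ uN].
exists (2%:R + \sum_(1 <= n < N.+1) modulus (c n) * s ^+ n) => n n1.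
have sum_ge0 : 0 <= \sum_(1 <= n < N.+1) modulus (c n) * s ^+ n.
  by apply: sumr_ge0 => i _; rewrite mulr_ge0 ?modulus_ge0 ?exprn_ge0 ?ltW.
have [nN|Nn] := leqP n N.
  rewrite (bigD1_seq n) ?iota_uniq ?mem_index_iota ?n1//=.
  rewrite addrCA lerDl addr_ge0//.
  by apply: sumr_ge0 => i _; rewrite mulr_ge0 ?modulus_ge0 ?exprn_ge0 ?ltW.
have h1 := uN n (ltnW Nn); have h2 := uN n.+1 (leqW (ltnW Nn)).
move: h1 h2; rewrite /= big_nat_recr//=.
rewrite !norm_modulus -[1 : R[i]]/(1%:C) !ltcR.
set u := \sum_(1 <= i < n) _; set v := c n * _ => h1 h2.
have vE : modulus (c n) * s ^+ n = modulus v by rewrite modulusM modulusX sE.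
have := modulusD (l - u) (- (l - (u + v))).
rewrite modulusN (_ : l - u - (l - (u + v)) = v); last by ring.
by rewrite vE; lra.
Qed.

Lemma cvg_conjc (R : realType) (u : nat -> R[i]) (l : R[i]) :
  u @ \oo --> l -> (fun n => (u n)^*%C) @ \oo --> l^*%C.
Proof.
move=> /cvgrPdist_lt ul; apply/cvgrPdist_lt => e e0.
apply: filterS (ul e e0) => n.
by rewrite -rmorphB normcJ.
Qed.

Lemma modulus_lim_le (R : realType) (u : nat -> R[i]) (l : R[i]) (B : R) :
  u @ \oo --> l -> (\forall n \near \oo, modulus (u n) <= B) -> modulus l <= B.
Proof.
move=> /cvgrPdist_lt ul uB; apply/ler_addgt0Pr => e e0.
have e0C : 0 < e%:C :> R[i] by rewrite ltcR.
have [n [un]] := filter_ex (filterI (ul _ e0C) uB).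
rewrite norm_modulus ltcR in un => nB.
have := modulusD (l - u n) (u n); rewrite subrK; lra.
Qed.

Lemma analytic_series_cvg (R : realType) (a b : nat -> R[i]) (z : R[i]) :
  analytic_series a -> analytic_series b -> disk z ->
  (fun N => \sum_(1 <= n < N) (a n * z ^+ n + (b n * z ^+ n)^*%C)) @ \oo -->
  (\big[+%R/0]_(1 <= n <oo) (a n * z ^+ n + (b n * z ^+ n)^*%C) : R[i]).
Proof.
move=> aa ab dz.
have [/cvg_ex[la /= al] _] := aa z dz.
have [/cvg_ex[lb /= bl] _] := ab z dz.
have uE : (fun N => \sum_(1 <= n < N) (a n * z ^+ n + (b n * z ^+ n)^*%C)) =
    (fun N => \sum_(1 <= n < N) a n * z ^+ n) +
    (fun N => (\sum_(1 <= n < N) b n * z ^+ n)^*%C).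
  by apply/funext => N; rewrite !fctE big_split rmorph_sum.
(* The infinite sum is by definition the limit of the partial sums, so convergence to some value is
   convergence to it. *)
have := cvgD al (cvg_conjc bl); rewrite -uE => h; exact: cvgP (h _).
Qed.

Lemma sqr_modulus_expr (R : realType) (l : nat) (z : R[i]) :
  (modulus z)%:C ^+ (2 * l) = (z * z^*%C) ^+ l.
Proof. by rewrite exprM mulC_conj rmorphXn. Qed.

Lemma zzbar_termE (R : realType) (a b : R[i]) (n l : nat) (z : R[i]) :
  (modulus z)%:C ^+ (2 * l) * (a * z ^+ n + (b * z ^+ n)^*%C) =
  zzbar_term a b n l z.
Proof.
have -> : zzbar_term a b n l z =
    a * ((modulus z)%:C ^+ (2 * l) * z ^+ n) +
    (b * ((modulus z)%:C ^+ (2 * l) * z ^+ n))^*%C.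
  by rewrite /zzbar_term /zzbar_mono sqr_modulus_expr exprMn exprD;
     congr (_ * _ + (_ * _)^*%C); ring.
rewrite mulrDr mulrCA; congr (_ + _).
have MJ : ((modulus z)%:C ^+ (2 * l))^*%C = (modulus z)%:C ^+ (2 * l).
  by rewrite -[_ ^+ (2 * l)](rmorphXn (real_complex R)); exact: conjc_real.
by rewrite [b * (_ * _)]mulrCA [RHS]rmorphM; congr (_ * _).
Qed.

Definition layer_tail (R : realType) (a b : nat -> R[i]) (l m : nat) (z : R[i]) : R[i] :=
  (modulus z)%:C ^+ (2 * l) *
    (\big[+%R/0]_(1 <= n <oo) (a n * z ^+ n + (b n * z ^+ n)^*%C) : R[i]) -
  \sum_(1 <= n < m) zzbar_term (a n) (b n) n l z.

(** The finite sums over [m <= n < N] satisfy the bound uniformly in [N], and the bound passes to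
    the limit at the two points [z] and [w]. The constant does not depend on [m]. *)
Lemma layer_tail_lipschitz (R : realType) (a b : nat -> R[i]) (l : nat) (s : R) :
  analytic_series a -> analytic_series b -> 0 < s < 1 ->
  exists C : R, forall (m : nat) (z w : R[i]), (1 <= m)%N ->
    modulus z <= s ^+ 3 -> modulus w <= s ^+ 3 ->
    modulus (layer_tail a b l m z - layer_tail a b l m w) <= C * s ^+ m * modulus (z - w).
Proof.
move=> aa ab s01; have /andP[s0 s1] := s01.
have [A aA] := analytic_series_bound aa s01.
have [B bB] := analytic_series_bound ab s01.
have abAB n : (1 <= n)%N -> (modulus (a n) + modulus (b n)) * s ^+ n <= A + B.
  by move=> n1; rewrite mulrDl lerD ?aA ?bB.
exists ((A + B) * (l.*2.+1)%:R / ((1 - s) ^+ 2 * s ^+ 3)) => m z w m1 zs ws.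
have s3 : s ^+ 3 < 1 by rewrite exprn_ilt1// ltW.
have dz : disk z by exact: le_lt_trans zs s3.
have dw : disk w by exact: le_lt_trans ws s3.
pose u x N := (modulus x)%:C ^+ (2 * l) *
  \sum_(1 <= n < N) (a n * x ^+ n + (b n * x ^+ n)^*%C) -
  \sum_(1 <= n < m) zzbar_term (a n) (b n) n l x.
have uf x : disk x -> u x @ \oo --> layer_tail a b l m x.
  move=> dx; apply: cvgB; last exact: cvg_cst.
  by apply: cvgM; [exact: cvg_cst|exact: analytic_series_cvg].
apply: (modulus_lim_le (cvgB (uf z dz) (uf w dw))).
exists m => // N /= mN.
have uE x : u x N = \sum_(m <= n < N) zzbar_term (a n) (b n) n l x.
  rewrite /u mulr_sumr; under eq_bigr do rewrite zzbar_termE.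
  by rewrite (big_cat_nat m1 mN)/= addrAC subrr add0r.
rewrite !fctE !uE -sumrB; apply: zzbar_term_tail => //; exact/andP.
Qed.

Definition truncation (R : realType) (p m : nat) (a b : nat -> nat -> R[i]) (z : R[i]) :=
  \sum_(1 <= k < p.+1) \sum_(1 <= n < m) zzbar_term (a n k) (b n k) n (k - 1) z.

Lemma truncation_lipschitz (R : realType) (p : nat) (F : R[i] -> R[i]) (a0 : R[i])
    (a b : nat -> nat -> R[i]) (s : R) :
  (forall k, (1 <= k <= p)%N ->
     analytic_series (fun n => a n k) /\ analytic_series (fun n => b n k)) ->
  (forall z, disk z -> F z = a0 + \sum_(1 <= k < p.+1) (modulus z)%:C ^+ (2 * (k - 1)) *
     (\big[+%R/0]_(1 <= n <oo) (a n k * z ^+ n + (b n k * z ^+ n)^*%C) : R[i])) ->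
  0 < s < 1 ->
  exists C : R, forall (m : nat) (z w : R[i]), (1 <= m)%N ->
    modulus z <= s ^+ 3 -> modulus w <= s ^+ 3 ->
    modulus (F z - truncation p m a b z - (F w - truncation p m a b w)) <=
    C * s ^+ m * modulus (z - w).
Proof.
move=> hab hF s01; have /andP[s0 s1] := s01.
(* A constant is chosen for every [k], with default [0] outside the layers. *)
have : forall k, exists C : R, (1 <= k <= p)%N ->
    forall (m : nat) (z w : R[i]), (1 <= m)%N ->
    modulus z <= s ^+ 3 -> modulus w <= s ^+ 3 ->
    modulus (layer_tail (fun n => a n k) (fun n => b n k) (k - 1) m z -
             layer_tail (fun n => a n k) (fun n => b n k) (k - 1) m w) <=
    C * s ^+ m * modulus (z - w).
  move=> k; have [/hab[aa ab]|] := boolP (1 <= k <= p)%N; last by exists 0.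
  by have [C hC] := layer_tail_lipschitz (k - 1) aa ab s01; exists C => _.
move=> /choice[C hC].
exists (\sum_(1 <= k < p.+1) C k) => m z w m1 zs ws.
have s3 : s ^+ 3 < 1 by rewrite exprn_ilt1// ltW.
rewrite (hF z (le_lt_trans zs s3)) (hF w (le_lt_trans ws s3)).
pose f k := layer_tail (fun n => a n k) (fun n => b n k) (k - 1) m.
set L := (X in modulus X); have -> : L = \sum_(1 <= k < p.+1) (f k z - f k w).
  by rewrite /L /f /layer_tail /truncation !sumrB; ring.
apply: le_trans (modulus_sum _ _ _) _; rewrite -mulrA mulr_suml.
by apply: ler_sum_nat => k kp; rewrite mulrA; exact: hC.
Qed.

(** * The dilatation inequality at every point *)

Lemma continuous_modulus (R : realType) : continuous (@modulus R).
Proof.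
move=> z; apply/(@cvgrPdist_lt _ _ _ (nbhs z)) => e e0.
have e0C : 0 < e%:C :> R[i] by rewrite ltcR.
have /cvgrPdist_lt/(_ _ e0C) : id w @[w --> z] --> z by exact: cvg_id.
apply: filterS => w; rewrite norm_modulus ltcR => zw.
have h1 := modulusD (z - w) w; have h2 := modulusD (w - z) z.
rewrite !subrK -(modulusN (w - z)) opprB in h1 h2.
by rewrite ltr_norml; apply/andP; split; lra.
Qed.

(** Radii of balls in [R[i]] are positive elements of [R[i]], hence real. *)
Lemma modulus_nbhs (R : realType) (z : R[i]) (P : set R[i]) : nbhs z P ->
  exists2 e : R, 0 < e & forall w, modulus (w - z) < e -> P w.
Proof.
move=> /nbhs_ballP[e /= e0 eP].
have eE : e = (complex.Re e)%:C by rewrite RRe_real// gtr0_real.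
exists (complex.Re e); first by move: e0; rewrite eE ltcR.
move=> w wz; apply: eP; rewrite -ball_normE /ball_ /= distrC eE norm_modulus ltcR//.
Qed.

(** If the inequality failed at [z], by continuity it would fail on an open square around [z], which
    has positive area but would lie in a null set. *)
Lemma ae_disk_le (R : realType) (f h : R[i] -> R) :
  (forall z, disk z -> {for z, continuous (fun w => f w - h w)}) ->
  {ae (@lebesgue_measure R \x @lebesgue_measure R)%E, forall w : R * R,
     disk (w.1 +i* w.2) -> f (w.1 +i* w.2) <= h (w.1 +i* w.2)} ->
  forall z, disk z -> f z <= h z.
Proof.
move=> gc [B [mB B0 gB]] z dz; rewrite leNgt -subr_gt0; apply/negP => gz.
have near_disk : \forall w \near z, disk w.
  have := @continuous_modulus R z; move/cvgr_lt; exact.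
have near_gt0 : \forall w \near z, 0 < f w - h w.
  by have := gc z dz; move/cvgr_gt; exact.
have [e e0 eP] := modulus_nbhs (filterI near_disk near_gt0).
case: z dz gz near_disk near_gt0 eP => x y dz gz _ _ eP.
(* Half the side is [e / 2], so that the sum of the two coordinate differences stays below [e]. *)
pose A (c : R) : set R := `]c - e / 2, c + e / 2[%classic.
have AB : A x `*` A y `<=` B.
  move=> [u v] [/= ux vy]; apply: gB => /=.
  have [|duv guv] := eP (u +i* v).
    apply: le_lt_trans (modulus_le_ReIm _) _ => /=.
    move: ux vy; rewrite /A /= !in_itv /= => /andP[u1 u2] /andP[v1 v2].
    have : `|u - x| < e / 2 by rewrite ltr_norml; apply/andP; split; lra.
    have : `|v - y| < e / 2 by rewrite ltr_norml; apply/andP; split; lra.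
    lra.
  by move=> /(_ duv); rewrite leNgt -subr_gt0 guv.
have mA c : measurable (A c) by exact: measurable_itv.
have muA c : lebesgue_measure (A c) = e%:E.
  rewrite /A lebesgue_measure_itv /= lte_fin ifT; last by lra.
  by rewrite -EFinB; congr EFin; lra.
pose mu := (@lebesgue_measure R \x @lebesgue_measure R)%E.
have muAA : mu (A x `*` A y) = (e%:E * e%:E)%E.
  rewrite /mu product_measure1E; first exact: (congr2 mule (muA x) (muA y)).
  - exact: mA.
  - exact: mA.
have : (mu (A x `*` A y) <= mu B)%E.
  apply: le_measure; [apply/mem_set|apply/mem_set; exact: mB|exact: AB].
  by apply: measurableX; exact: mA.
by rewrite muAA /mu B0 -EFinM lee_fin leNgt mulr_gt0.
Qed.

(** Here [dil] is [Lambda ^+ 2 - K * jacobian_det] as a function of the values of [dx] and [dy]; its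
    convergence gives the continuity required by [ae_disk_le]. *)
Lemma cvg_dilatation (R : realType) (K : R) (T : Type) (G : set_system T)
    (fx fy : T -> R[i]) (lx ly : R[i]) : Filter G ->
  fx @ G --> lx -> fy @ G --> ly ->
  let dil u v := (modulus ((u - 'i * v) / 2%:R) + modulus ((u + 'i * v) / 2%:R)) ^+ 2 -
    K * (modulus ((u - 'i * v) / 2%:R) ^+ 2 - modulus ((u + 'i * v) / 2%:R) ^+ 2) in
  dil (fx t) (fy t) @[t --> G] --> dil lx ly.
Proof.
move=> FG fxl fyl dil.
have iyl : 'i * fy t @[t --> G] --> 'i * ly by exact: (cvgM (cvg_cst 'i) fyl).
have modl (f : T -> R[i]) l : f @ G --> l -> modulus (f t) @[t --> G] --> modulus l.
  by move=> fl; exact: cvg_comp fl (@continuous_modulus R l).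
have minusl : modulus ((fx t - 'i * fy t) / 2%:R) @[t --> G] -->
    modulus ((lx - 'i * ly) / 2%:R).
  by apply: modl; exact: (cvgM (cvgB fxl iyl) (cvg_cst (2%:R^-1 : R[i]))).
have plusl : modulus ((fx t + 'i * fy t) / 2%:R) @[t --> G] -->
    modulus ((lx + 'i * ly) / 2%:R).
  by apply: modl; exact: (cvgM (cvgD fxl iyl) (cvg_cst (2%:R^-1 : R[i]))).
apply: cvgB; first by apply: (cvgM (cvgD minusl plusl) (cvgD minusl plusl)).
apply: cvgM; first exact: cvg_cst.
by apply: cvgB; [exact: (cvgM minusl minusl)|exact: (cvgM plusl plusl)].
Qed.

Lemma quasiregular_dilatation (R : realType) (K : R) (F : R[i] -> R[i]) :
  quasiregular K F ->
  (forall z, disk z -> {for z, continuous (dx F)}) ->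
  (forall z, disk z -> {for z, continuous (dy F)}) ->
  forall z, disk z -> Lambda F z ^+ 2 <= K * jacobian_det F z.
Proof.
move=> [_ _ _ _ ae_dil] cdx cdy; apply: ae_disk_le ae_dil => w dw.
exact: (cvg_dilatation (nbhs_filter w) (cdx w dw) (cdy w dw)).
Qed.

(* As [J] is the product of [Lambda] and [|dz| - |dzbar|], the hypothesis
   gives [Lambda <= K lambda_F]; and [Lambda^2 + lambda_F^2] is the left side
   doubled. *)
Lemma quasiregular_energy (R : realType) (K lambda : R) (F : R[i] -> R[i]) z :
  1 <= K -> 0 <= jacobian_det F z -> lambda_min F z <= lambda ->
  Lambda F z ^+ 2 <= K * jacobian_det F z ->
  2%:R * (modulus (dz F z) ^+ 2 + modulus (dzbar F z) ^+ 2) <=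
    (K ^+ 2 + 1) * lambda ^+ 2.
Proof.
rewrite /jacobian_det /lambda_min /Lambda => K1.
move: (modulus_ge0 (dz F z)) (modulus_ge0 (dzbar F z)).
move: (modulus (dz F z)) (modulus (dzbar F z)) => u v u0 v0 uv.
have vu : v <= u by rewrite -(@ler_pXn2r _ 2%N)// -subr_ge0.
rewrite ger0_norm ?subr_ge0// => ul dil.
have uvK : u + v <= K * (u - v).
  (* The inequality is divided by [u + v] when this is positive; otherwise the left side is at most
     zero. *)
  have [uv0|uv0] := leP (u + v) 0; last first.
    rewrite -(ler_pM2l uv0) -expr2 (le_trans dil)// le_eqVlt.
    by apply/orP; left; apply/eqP; ring.
  by rewrite (le_trans uv0)// mulr_ge0 ?subr_ge0// (le_trans _ K1).
have -> : 2%:R * (u ^+ 2 + v ^+ 2) = (u + v) ^+ 2 + (u - v) ^+ 2 by ring.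
have l0 : 0 <= lambda by rewrite (le_trans _ ul)// subr_ge0.
have K0 : 0 <= K := le_trans ler01 K1.
have ulK : u + v <= K * lambda by rewrite (le_trans uvK)// ler_wpM2l.
rewrite mulrDl mul1r -exprMn.
by rewrite lerD// lerXn2r ?nnegrE ?subr_ge0 ?addr_ge0 ?mulr_ge0.
Qed.

(** * Coefficient estimates *)

(** Multiplying the derivatives by [z] and by its conjugate restores the monomial and removes the
    truncated exponents. *)
Lemma wirtinger_mono (R : realType) (n l : nat) (z : R[i]) : exists P Q : R[i],
  [/\ wirtinger (zzbar_mono n l) z P Q,
      z * P = (n + l)%:R * zzbar_mono n l z &
      z^*%C * Q = l%:R * zzbar_mono n l z].
Proof.
have expr_pred i (x : R[i]) : i%:R * (x * x ^+ i.-1) = i%:R * x ^+ i.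
  by case: i => [|i]; rewrite ?mul0r//= exprS.
exists ((n + l)%:R * z ^+ (n + l).-1 * z^*%C ^+ l).
exists (l%:R * z ^+ (n + l) * z^*%C ^+ l.-1); split.
- apply: wirtinger_eq (wirtingerM (wirtingerX (n + l) (@wirtinger_id R z))
    (wirtingerX l (wirtingerJ (@wirtinger_id R z)))) _ _.
  + by rewrite conjc0 /=; ring.
  + by rewrite conjc1 /=; ring.
- transitivity (((n + l)%:R * (z * z ^+ (n + l).-1)) * z^*%C ^+ l); first by ring.
  by rewrite expr_pred /zzbar_mono; ring.
- transitivity (z ^+ (n + l) * (l%:R * (z^*%C * z^*%C ^+ l.-1))); first by ring.
  by rewrite expr_pred /zzbar_mono; ring.
Qed.

(** Conjugating the [b] part exchanges its two derivatives, hence its factors [n + l] and [l]. *)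
Lemma wirtinger_term (R : realType) (a b : R[i]) (n l : nat) (z : R[i]) :
  exists PQ : R[i] * R[i],
  [/\ wirtinger (zzbar_term a b n l) z PQ.1 PQ.2,
      z * PQ.1 = (n + l)%:R * (a * zzbar_mono n l z) +
                 l%:R * (b * zzbar_mono n l z)^*%C &
      z^*%C * PQ.2 = l%:R * (a * zzbar_mono n l z) +
                 (n + l)%:R * (b * zzbar_mono n l z)^*%C].
Proof.
have [P [Q [PQ zP zQ]]] := wirtinger_mono n l z.
have cM c : wirtinger (fun w => c * zzbar_mono n l w) z (c * P) (c * Q).
  by apply: wirtinger_eq (wirtingerM (@wirtinger_cst R c z) PQ) _ _; rewrite mulr0 addr0.
exists (a * P + (b * Q)^*%C, a * Q + (b * P)^*%C); split => /=.
- exact: wirtingerD (cM a) (wirtingerJ (cM b)).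
- have -> : z * (a * P + (b * Q)^*%C) = a * (z * P) + (b * (z^*%C * Q))^*%C.
    by rewrite !rmorphM /= conjcK; ring.
  by rewrite zP zQ !rmorphM /= conjc_nat; ring.
- have -> : z^*%C * (a * Q + (b * P)^*%C) = a * (z^*%C * Q) + (b * (z * P))^*%C.
    by rewrite !rmorphM /=; ring.
  by rewrite zP zQ !rmorphM /= conjc_nat; ring.
Qed.

(** Up to conjugation, this is a Fourier coefficient on the circle of radius [r]: all layers
    contribute to the same frequency, with weights [c k] produced by differentiation. *)
Definition layer_sum (R : realType) (p n : nat) (c : nat -> R) (u : nat -> R[i])
    (r : R) : R[i] :=
  \sum_(1 <= k < p.+1) (c k * r ^+ (n + 2 * (k - 1)))%:C * u k.

Lemma zzbar_mono_circle (R : realType) (n l : nat) (r : R) (z : R[i]) :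
  modulus z = 1 -> zzbar_mono n l (r%:C * z) = (r ^+ (n + 2 * l))%:C * z ^+ n.
Proof.
move=> z1; rewrite /zzbar_mono.
have -> : (r%:C * z)^*%C = r%:C * z^*%C.
  by rewrite rmorphM; congr (_ * _); exact: conjc_real.
have -> : (r ^+ (n + 2 * l))%:C = r%:C ^+ n * (r%:C ^+ l * r%:C ^+ l) :> R[i].
  by rewrite -exprMn -expr2 -exprM -exprD -[RHS](rmorphXn (real_complex R)).
have zz : z ^+ l * z^*%C ^+ l = 1 by rewrite -exprMn mulC_conj z1 expr1n expr1n.
transitivity (r%:C ^+ n * (r%:C ^+ l * r%:C ^+ l) * z ^+ n * (z ^+ l * z^*%C ^+ l)).
  by rewrite !exprMn !exprD; ring.
by rewrite zz mulr1.
Qed.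

(** Exchanging the sums over layers and frequencies collects the terms of equal frequency. *)
Lemma wirtinger_truncation (R : realType) (p m : nat) (a b : nat -> nat -> R[i])
    (r : R) (z : R[i]) : modulus z = 1 ->
  let hi n k := (n + (k - 1))%:R : R in
  let lo (n k : nat) := (k - 1)%:R : R in
  exists PQ : R[i] * R[i],
  [/\ wirtinger (truncation p m a b) (r%:C * z) PQ.1 PQ.2,
      (r%:C * z) * PQ.1 = trig_poly m (fun n => layer_sum p n (hi n) (a n) r)
        (fun n => (layer_sum p n (lo n) (b n) r)^*%C) z &
      (r%:C * z)^*%C * PQ.2 = trig_poly m (fun n => layer_sum p n (lo n) (a n) r)
        (fun n => (layer_sum p n (hi n) (b n) r)^*%C) z].
Proof.
move=> z1 hi lo; set x := r%:C * z.
have scaleE (c : nat) (t : R) (u v : R[i]) :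
    c%:R * (u * (t%:C * v)) = (c%:R * t)%:C * u * v.
  have -> : (c%:R * t)%:C = c%:R * t%:C :> R[i] by rewrite rmorphM rmorph_nat.
  by ring.
have scaleJE (c : nat) (t : R) (u v : R[i]) :
    c%:R * (u * (t%:C * v))^*%C = ((c%:R * t)%:C * u)^*%C * v^*%C.
  by rewrite -[(c%:R : R[i])]conjc_nat -!(rmorphM conjc) scaleE.
have /choice[g hg] : forall nk : nat * nat, exists PQ : R[i] * R[i], _ :=
  fun nk => wirtinger_term (a nk.1 nk.2) (b nk.1 nk.2) nk.1 (nk.2 - 1) x.
exists (\sum_(1 <= k < p.+1) \sum_(1 <= n < m) (g (n, k)).1,
        \sum_(1 <= k < p.+1) \sum_(1 <= n < m) (g (n, k)).2); split => /=.
- apply: wirtinger_sum => k _; apply: wirtinger_sum => n _.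
  by have [] := hg (n, k).
- rewrite exchange_big mulr_sumr /=; apply: eq_bigr => n _.
  rewrite rmorph_sum !mulr_suml mulr_sumr -big_split /=; apply: eq_bigr => k _.
  have [_ -> _] /= := hg (n, k).
  by rewrite (zzbar_mono_circle _ _ _ z1) scaleE scaleJE.
- rewrite exchange_big mulr_sumr /=; apply: eq_bigr => n _.
  rewrite rmorph_sum !mulr_suml mulr_sumr -big_split /=; apply: eq_bigr => k _.
  have [_ _ ->] /= := hg (n, k).
  by rewrite (zzbar_mono_circle _ _ _ z1) scaleE scaleJE.
Qed.

(** Expanding [(u + e)^2 + (v + e)^2] leaves the cross terms [2 e (u + v)], and both [u] and [v] are
    at most [B + 1]. *)
Lemma approx_sqr_sum (R : realType) (u v P Q e B : R) :
  0 <= u -> 0 <= v -> 0 <= P -> 0 <= Q -> P <= u + e -> Q <= v + e -> 0 <= e ->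
  u ^+ 2 + v ^+ 2 <= B ->
  P ^+ 2 + Q ^+ 2 <= B + e * (4%:R * (B + 1) + 2%:R * e).
Proof.
move=> u0 v0 P0 Q0 Pu Qv e0 uvB.
have uB : u <= B + 1 by have := sqr_ge0 (u - 1); have := sqr_ge0 v; nra.
have vB : v <= B + 1 by have := sqr_ge0 (v - 1); have := sqr_ge0 u; nra.
have P2 : P ^+ 2 <= (u + e) ^+ 2 by rewrite lerXn2r ?nnegrE ?addr_ge0.
have Q2 : Q ^+ 2 <= (v + e) ^+ 2 by rewrite lerXn2r ?nnegrE ?addr_ge0.
have ue : e * u <= e * (B + 1) by rewrite ler_wpM2l.
have ve : e * v <= e * (B + 1) by rewrite ler_wpM2l.
by move: P2 Q2 ue ve uvB; rewrite !expr2; nra.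
Qed.

Lemma le_geometric_limit (R : realType) (X B D s : R) (n : nat) : 0 < s < 1 ->
  0 <= D -> (forall m, (n < m)%N -> X <= B + D * s ^+ m) -> X <= B.
Proof.
move=> /andP[s0 s1] D0 XB; apply/ler_addgt0Pr => e e0.
have sm : (fun m => s ^+ m) @ \oo --> (0 : R).
  by apply: cvg_expr; rewrite gtr0_norm.
(* Division is by [D + 1], because [D] may be zero. *)
have D1 : 0 < D + 1 by rewrite ltr_wpDl.
move/cvgrPdist_lt : sm => /(_ (e / (D + 1)) (divr_gt0 e0 D1)).
move=> [N _ /(_ (maxn N n.+1) (leq_maxl _ _))] /=.
rewrite sub0r normrN gtr0_norm ?exprn_gt0// ltr_pdivlMr// => smd.
apply: le_trans (XB (maxn N n.+1) (leq_maxr _ _)) _; rewrite lerD2l.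
have := exprn_ge0 (maxn N n.+1) (ltW s0); move: smd; rewrite mulrDr mulr1 mulrC.
lra.
Qed.

(** On the circle of radius [r] the truncation satisfies the pointwise bound [B] up to an error of
    order [s ^+ m]. Bessel's inequality at [2m] roots of unity carries this to the coefficients of
    frequencies [n] and [-n], which do not depend on [m], and [m] then tends to infinity. *)
Lemma polyharmonic_coef_energy (R : realType) (p n : nat) (F : R[i] -> R[i]) (a0 : R[i])
    (a b : nat -> nat -> R[i]) (B r : R) :
  (forall k, (1 <= k <= p)%N ->
     analytic_series (fun n => a n k) /\ analytic_series (fun n => b n k)) ->
  (forall z, disk z -> F z = a0 + \sum_(1 <= k < p.+1) (modulus z)%:C ^+ (2 * (k - 1)) *
     (\big[+%R/0]_(1 <= n <oo) (a n k * z ^+ n + (b n k * z ^+ n)^*%C) : R[i])) ->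
  (forall z, disk z -> has_partials F z) ->
  (forall z, disk z -> modulus (dz F z) ^+ 2 + modulus (dzbar F z) ^+ 2 <= B) ->
  0 < r < 1 -> (1 <= n)%N ->
  modulus (layer_sum p n (fun k => (n + (k - 1))%:R) (a n) r) ^+ 2 +
  modulus (layer_sum p n (fun k => (k - 1)%:R) (b n) r) ^+ 2 +
  (modulus (layer_sum p n (fun k => (k - 1)%:R) (a n) r) ^+ 2 +
   modulus (layer_sum p n (fun k => (n + (k - 1))%:R) (b n) r) ^+ 2)
  <= B.
Proof.
move=> hab hF Fpart FB /andP[r0 r1] n1.
(* With [h = (1 - r) / 4] one has [s = 1 - h] and [s^3 >= 1 - 3h > 1 - 4h = r], which leaves room
   around the circle for the Lipschitz estimate. *)
pose s := (3%:R + r) / 4%:R.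
have s01 : 0 < s < 1 by apply/andP; split; rewrite /s; lra.
have rs : r < s ^+ 3.
  have : 0 < (1 - r) / 4%:R by rewrite divr_gt0 ?subr_gt0.
  have -> : s = 1 - (1 - r) / 4%:R by rewrite /s; field.
  have {2}-> : r = 1 - 4%:R * ((1 - r) / 4%:R) by field.
  have : (1 - r) / 4%:R < 1 by lra.
  move: ((1 - r) / 4%:R) => h h1 h0; rewrite !exprS expr0; nra.
have [C0 hC0] := truncation_lipschitz hab hF s01.
pose C := Num.max C0 0.
have CC0 : 0 <= C by rewrite le_max lexx orbT.
have hC m z w : (1 <= m)%N -> modulus z <= s ^+ 3 -> modulus w <= s ^+ 3 ->
    modulus (F z - truncation p m a b z - (F w - truncation p m a b w)) <=
    C * s ^+ m * modulus (z - w).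
  move=> m1 zs ws; apply: le_trans (hC0 m z w m1 zs ws) _.
  rewrite ler_wpM2r ?modulus_ge0// ler_wpM2r ?exprn_ge0//; last by rewrite le_max lexx.
  by case/andP: s01 => /ltW.
have B0 : 0 <= B.
  have d0 : disk (0 : R[i]) by rewrite /disk /mkset modulus0.
  by apply: le_trans (FB 0 d0); rewrite addr_ge0 ?sqr_ge0.
(* A generous constant: with [e = 2 C s^m], the inner [e] is bounded using [s ^+ m <= 1], and the
   outer one supplies the decay. *)
apply: (@le_geometric_limit _ _ _
  (2%:R * (2%:R * C) * (4%:R * (B + 1) + 2%:R * (2%:R * (2%:R * C)))) s n) => // [|m nm].
  by rewrite !mulr_ge0 ?addr_ge0 ?mulr_ge0 ?addr_ge0.
have m0 : (0 < m)%N := leq_trans (ltn0Sn n) nm.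
pose e := 2%:R * (C * s ^+ m).
have s0 : 0 < s by case/andP: s01.
have sm1 : s ^+ m <= 1 by rewrite exprn_ile1// ?ltW//; case/andP: s01.
have sm0 : 0 <= s ^+ m by rewrite exprn_ge0// ltW.
have e0 : 0 <= e by rewrite !mulr_ge0.
have circle z : modulus z = 1 ->
    modulus (trig_poly m (fun n => layer_sum p n (fun k => (n + (k - 1))%:R) (a n) r)
      (fun n => (layer_sum p n (fun k => (k - 1)%:R) (b n) r)^*%C) z) ^+ 2 +
    modulus (trig_poly m (fun n => layer_sum p n (fun k => (k - 1)%:R) (a n) r)
      (fun n => (layer_sum p n (fun k => (n + (k - 1))%:R) (b n) r)^*%C) z) ^+ 2
    <= B + e * (4%:R * (B + 1) + 2%:R * e).
  move=> z1; have [[P Q] /= [PQ <- <-]] := @wirtinger_truncation R p m a b r z z1.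
  set x := r%:C * z.
  have xr : modulus x = r by rewrite modulusM modulus_real z1 mulr1 gtr0_norm.
  have dx : disk x by rewrite /disk /mkset xr.
  have rs0 : 0 < s ^+ 3 - r by rewrite subr_gt0.
  have Lip w : modulus (w - x) < s ^+ 3 - r ->
      modulus (F w - truncation p m a b w - (F x - truncation p m a b x)) <=
      C * s ^+ m * modulus (w - x).
    move=> wx; apply: hC => //; last by rewrite xr ltW.
    by have := modulusD (w - x) x; rewrite subrK xr; lra.
  have [zP zQ] := wirtinger_approx rs0 (Fpart x dx) PQ Lip.
  have -> : modulus (x * P) = r * modulus P by rewrite modulusM xr.
  have -> : modulus (x^*%C * Q) = r * modulus Q by rewrite modulusM modulusJ xr.
  rewrite !exprMn -mulrDr.
  (* The factor [r ^+ 2] coming from [x] is at most [1]. *)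
  apply: (@le_trans _ _ (modulus P ^+ 2 + modulus Q ^+ 2)).
    rewrite ler_piMl ?addr_ge0 ?sqr_ge0//.
    by rewrite exprn_ile1// ltW.
  apply: (approx_sqr_sum _ _ _ _ _ _ e0 (FB x dx)); rewrite ?modulus_ge0//.
    have := modulusD (dz F x) (- (dz F x - P)).
    by rewrite modulusN opprB addrC subrK /e; lra.
  have := modulusD (dzbar F x) (- (dzbar F x - Q)).
  by rewrite modulusN opprB addrC subrK /e; lra.
have [w wN] : exists w : R[i], (m.*2).-primitive_root w.
  by apply: exists_prim_root; rewrite double_gt0.
have nm' : (1 <= n < m)%N by rewrite n1.
apply: (@le_trans _ _ (B + e * (4%:R * (B + 1) + 2%:R * e))); last first.
  rewrite lerD2l /e.
  have -> : 2%:R * (2%:R * C) * (4%:R * (B + 1) + 2%:R * (2%:R * (2%:R * C))) * s ^+ m =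
     2%:R * (C * s ^+ m) *
     (2%:R * (4%:R * (B + 1)) + 2%:R * (2%:R * (2%:R * (2%:R * C)))) by ring.
  rewrite ler_wpM2l//.
  have : C * s ^+ m <= C by rewrite ler_piMr.
  lra.
have N0 : 0 < m.*2%:R :> R by rewrite ltr0n double_gt0.
rewrite -(ler_pM2l N0).
have b1 := trig_poly_bessel
  (fun n => layer_sum p n (fun k => (n + (k - 1))%:R) (a n) r)
  (fun n => (layer_sum p n (fun k => (k - 1)%:R) (b n) r)^*%C) wN nm'.
have b2 := trig_poly_bessel
  (fun n => layer_sum p n (fun k => (k - 1)%:R) (a n) r)
  (fun n => (layer_sum p n (fun k => (n + (k - 1))%:R) (b n) r)^*%C) wN nm'.
rewrite !modulusJ in b1 b2.
rewrite mulrDr; apply: le_trans (lerD b1 b2) _; rewrite -big_split /=.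
have -> : m.*2%:R = \sum_(j < m.*2) 1 :> R by rewrite sumr_const card_ord.
rewrite mulr_suml.
apply: ler_sum => j _; rewrite mul1r; apply: circle.
exact: modulus_prim_root wN.
Qed.

(** The product is [x / y] times [|y|^2], and the real part of [x / y] is its modulus times the
    cosine of an angle of absolute value at most [pi / 2]. If [x] or [y] is zero, so is the
    product. *)
Lemma Re_mulJ_principal_arg (R : realType) (x y : R[i]) :
  (x != 0 -> y != 0 -> `|principal_arg (x / y)| <= pi / 2%:R) ->
  0 <= complex.Re (x * y^*%C).
Proof.
move=> xy; have [->|x0] := eqVneq x 0; first by rewrite mul0r.
have [->|y0] := eqVneq y 0; first by rewrite conjc0 mulr0.
have q0 : x / y != 0 by rewrite mulf_neq0// invr_neq0.
have [_] := principal_argP q0; have := xy x0 y0; set t := principal_arg _.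
rewrite ler_norml => /andP[t1 t2] qE.
have cos_t : 0 <= cos t by apply: cos_ge0_pihalf; rewrite t1.
have -> : x * y^*%C = x / y * (modulus y ^+ 2)%:C.
  by rewrite -mulC_conj mulrA divfK.
rewrite qE /= mulr0 subr0.
by rewrite !mulr_ge0 ?modulus_ge0 ?sqr_ge0.
Qed.

(** With [x] the term of index [k] and [y] the sum of the others, [|x + y|^2] is [|x|^2 + |y|^2]
    plus twice the nonnegative real part of [x] times the conjugate of [y]. *)
Lemma modulus_sum_ge (R : realType) (p k : nat) (c : nat -> R) (u : nat -> R[i]) :
  (forall i j, (1 <= i <= p)%N -> (1 <= j <= p)%N -> 0 <= complex.Re (u i * (u j)^*%C)) ->
  (forall i, 0 <= c i) -> (1 <= k <= p)%N ->
  c k * modulus (u k) <= modulus (\sum_(1 <= i < p.+1) (c i)%:C * u i).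
Proof.
move=> upos c0 kp.
rewrite (bigD1_seq k) ?iota_uniq ?mem_index_iota//=.
set x := (c k)%:C * u k; set y := \sum_(i <- _ | _) _.
have -> : c k * modulus (u k) = modulus x by rewrite modulusM modulus_real ger0_norm.
have xy : 0 <= complex.Re (x * y^*%C).
  rewrite /y rmorph_sum mulr_sumr raddf_sum /= big_seq_cond.
  apply: sumr_ge0 => i /andP[]; rewrite mem_index_iota => ip _.
  have -> : x * ((c i)%:C * u i)^*%C = (c k * c i)%:C * (u k * (u i)^*%C).
    rewrite /x; case: (u k) (u i) => [? ?] [? ?].
    by apply/eqP; rewrite eq_complex /=; apply/andP; split; apply/eqP; ring.
  have := upos k i kp ip; case: (u k * _) => [? ?] /= ge0.
  by rewrite mul0r subr0 !mulr_ge0.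
rewrite -(@ler_pXn2r _ 2%N) ?nnegrE ?modulus_ge0//.
move: xy; rewrite !sqr_modulus; case: x y => [x1 x2] [y1 y2] /=.
have := sqr_ge0 y1; have := sqr_ge0 y2; nra.
Qed.

Lemma le_expr_limit (R : realType) (X B : R) (j : nat) :
  (forall r, 0 < r < 1 -> r ^+ j * X <= B) -> X <= B.
Proof.
move=> XB; rewrite leNgt; apply/negP => BX.
have Xc : r ^+ j * X @[r --> (1 : R)] --> X.
  have jc : r ^+ j @[r --> (1 : R)] --> (1 : R) ^+ j by exact: exprn_continuous.
  by have := cvgM jc (cvg_cst X); rewrite expr1n mul1r; apply.
have near_B : \forall r \near (1 : R)^'-, B < r ^+ j * X.
  exact: cvgr_gt (cvg_at_left_filter Xc) _ BX.
have near0 : \forall r \near (1 : R)^'-, 0 < r by exact: nbhs_left_gt.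
have near1 : \forall r \near (1 : R)^'-, r < 1 by exact: nbhs_left_lt.
have [r [rB [r0 r1]]] := filter_ex (filterI near_B (filterI near0 near1)).
by have := XB r; rewrite r0 r1 leNgt rB => /(_ isT).
Qed.

Lemma polyharmonic_coef_bound (R : realType) (p n k : nat) (F : R[i] -> R[i]) (a0 : R[i])
    (a b : nat -> nat -> R[i]) (M lambda D : R) :
  (forall k, (1 <= k <= p)%N ->
     analytic_series (fun n => a n k) /\ analytic_series (fun n => b n k)) ->
  (forall z, disk z -> F z = a0 + \sum_(1 <= k < p.+1) (modulus z)%:C ^+ (2 * (k - 1)) *
     (\big[+%R/0]_(1 <= n <oo) (a n k * z ^+ n + (b n k * z ^+ n)^*%C) : R[i])) ->
  (forall z, disk z -> has_partials F z) ->
  (forall z, disk z -> 2%:R * (modulus (dz F z) ^+ 2 + modulus (dzbar F z) ^+ 2) <=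
     M * lambda ^+ 2) ->
  (forall i j, (1 <= i <= p)%N -> (1 <= j <= p)%N -> 0 <= complex.Re (a n i * (a n j)^*%C)) ->
  (forall i j, (1 <= i <= p)%N -> (1 <= j <= p)%N -> 0 <= complex.Re (b n i * (b n j)^*%C)) ->
  0 <= lambda -> 0 <= M -> 0 < D -> (1 <= n)%N -> (1 <= k <= p)%N ->
  D <= ((n + (k - 1)) ^ 2 + (k - 1) ^ 2)%:R ->
  modulus (a n k) + modulus (b n k) <= lambda * Num.sqrt M / Num.sqrt D.
Proof.
move=> hab hF Fpart FM apos bpos l0 M0 D0 n1 kp hD.
pose h : R := (n + (k - 1))%:R; pose l : R := (k - 1)%:R.
set x := modulus (a n k); set y := modulus (b n k).
have x0 : 0 <= x := modulus_ge0 _; have y0 : 0 <= y := modulus_ge0 _.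
have FM2 z : disk z -> modulus (dz F z) ^+ 2 + modulus (dzbar F z) ^+ 2 <=
    M * lambda ^+ 2 / 2%:R.
  by move=> dz0; rewrite ler_pdivlMr// mulrC FM.
have key : (h ^+ 2 + l ^+ 2) * (x ^+ 2 + y ^+ 2) <= M * lambda ^+ 2 / 2%:R.
  (* The exponent is that of [r] in the square of the term of index [k] of [layer_sum]. *)
  apply: (@le_expr_limit _ _ _ ((n + 2 * (k - 1)) * 2)) => r r01.
  have := polyharmonic_coef_energy hab hF Fpart FM2 r01 n1.
  apply: le_trans; have r0 : 0 <= r by case/andP: r01 => /ltW.
  set t := r ^+ (n + 2 * (k - 1)).
  have t0 : 0 <= t by exact: exprn_ge0.
  have sq (c : nat -> R) (u : nat -> R[i]) : (forall i, 0 <= c i) ->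
      (forall i j, (1 <= i <= p)%N -> (1 <= j <= p)%N -> 0 <= complex.Re (u i * (u j)^*%C)) ->
      (c k * t * modulus (u k)) ^+ 2 <= modulus (layer_sum p n c u r) ^+ 2.
    move=> c0 upos; rewrite lerXn2r ?nnegrE ?modulus_ge0 ?mulr_ge0 ?modulus_ge0//.
    apply: (modulus_sum_ge (c := fun i => c i * r ^+ (n + 2 * (i - 1)))) => // i.
    by rewrite mulr_ge0 ?exprn_ge0.
  have h1 := sq (fun k => (n + (k - 1))%:R) (a n) (fun=> ler0n _ _) apos.
  have h2 := sq (fun k => (k - 1)%:R) (b n) (fun=> ler0n _ _) bpos.
  have h3 := sq (fun k => (k - 1)%:R) (a n) (fun=> ler0n _ _) apos.
  have h4 := sq (fun k => (n + (k - 1))%:R) (b n) (fun=> ler0n _ _) bpos.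
  apply: le_trans (lerD (lerD h1 h2) (lerD h3 h4)).
  rewrite le_eqVlt exprM -/t -/x -/y -/h -/l; apply/orP; left; apply/eqP; ring.
have hD' : D <= h ^+ 2 + l ^+ 2 by rewrite -!natrX -natrD.
have xyD : (x + y) ^+ 2 * D <= M * lambda ^+ 2.
  (* This factor [2] cancels the division by [2] in [key]. *)
  have xy2 : (x + y) ^+ 2 <= 2%:R * (x ^+ 2 + y ^+ 2) by have := sqr_ge0 (x - y); nra.
  have := ler_pM (sqr_ge0 _) (ltW D0) xy2 hD'; move: key; lra.
rewrite ler_pdivlMr ?sqrtr_gt0//.
rewrite -(@ler_pXn2r _ 2%N)// ?nnegrE ?mulr_ge0 ?addr_ge0 ?sqrtr_ge0//.
by rewrite !exprMn !sqr_sqrtr ?(ltW D0)// [leRHS]mulrC.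
Qed.

Theorem corollary2p1 (R : realType) (K : R) (p : nat) (F : R[i] -> R[i])
  (a0 : R[i]) (a b : nat -> nat -> R[i]) (lambda : R)
  (hK : 1 <= K) (hp : (1 <= p)%N)
  (hqr : quasiregular K F) (hpoly : polyharmonic p F)
  (hanalytic : forall k : nat, (1 <= k <= p)%N ->
     analytic_series (fun n => a n k) /\ analytic_series (fun n => b n k))
  (hF : forall z : R[i], disk z ->
     F z = a0 + \sum_(1 <= k < p.+1) (modulus z)%:C ^+ (2 * (k - 1)) *
       \big[+%R/0]_(1 <= n <oo) (a n k * z ^+ n + (b n k * z ^+ n)^*))
  (harga : forall n k1 k2 : nat, (1 <= n)%N ->
     (1 <= k1 <= p)%N -> (1 <= k2 <= p)%N -> a n k1 != 0 -> a n k2 != 0 ->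
     `|principal_arg (a n k1 / a n k2)| <= pi / 2%:R)
  (hargb : forall n k3 k4 : nat, (1 <= n)%N ->
     (1 <= k3 <= p)%N -> (1 <= k4 <= p)%N -> b n k3 != 0 -> b n k4 != 0 ->
     `|principal_arg (b n k3 / b n k4)| <= pi / 2%:R)
  (hlambda : forall z : R[i], disk z -> lambda_min F z <= lambda) :
  [/\ forall n : nat, (2 <= n)%N ->
        modulus (a n 1%N) + modulus (b n 1%N)
          <= lambda * Num.sqrt (K ^+ 2 + 1) / n%:R,
      forall n k : nat, (2 <= n)%N -> (2 <= k <= p)%N ->
        modulus (a n k) + modulus (b n k)
          <= lambda * Num.sqrt (K ^+ 2 + 1) / Num.sqrt 10%:R &
      forall k : nat, (2 <= k <= p)%N ->
        modulus (a 1%N k) + modulus (b 1%N k)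
          <= lambda * Num.sqrt (K ^+ 2 + 1) / Num.sqrt 5%:R].
Proof.
have [_ _ Fsense _ _] := hqr.
have [Fpart cdx cdy] : [/\ forall z, disk z -> has_partials F z,
    forall z, disk z -> {for z, continuous (dx F)} &
    forall z, disk z -> {for z, continuous (dy F)}].
  (* As [1 <= p], there are at least two orders of continuous differentiability, so the first
     partials exist and are continuous. *)
  case: hpoly => + _; case: p hp {hanalytic hF harga hargb} => // q _.
  by rewrite mulnS => -[_ [Fp [cx _] [cy _]]].
have FM z : disk z -> 2%:R * (modulus (dz F z) ^+ 2 + modulus (dzbar F z) ^+ 2) <=
    (K ^+ 2 + 1) * lambda ^+ 2.
  move=> dz0; apply: quasiregular_energy (hlambda z dz0) _ => //; first exact: Fsense.
  exact: quasiregular_dilatation.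
have l0 : 0 <= lambda.
  have d0 : disk (0 : R[i]) by rewrite /disk /mkset modulus0.
  exact: le_trans (normr_ge0 _) (hlambda 0 d0).
have M0 : 0 <= K ^+ 2 + 1 by rewrite addr_ge0 ?sqr_ge0.
have bound D n k : 0 < D -> (1 <= n)%N -> (1 <= k <= p)%N ->
    D <= ((n + (k - 1)) ^ 2 + (k - 1) ^ 2)%:R ->
    modulus (a n k) + modulus (b n k) <= lambda * Num.sqrt (K ^+ 2 + 1) / Num.sqrt D.
  move=> D0 n1 kp; apply: (polyharmonic_coef_bound hanalytic hF Fpart FM) => // i j ip jp.
  - by apply: Re_mulJ_principal_arg; exact: harga.
  - by apply: Re_mulJ_principal_arg; exact: hargb.
split.
(* For [k = 1] the weight is [n ^ 2 + 0 ^ 2], so [D] is [n ^ 2]. *)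
- move=> n n2; have -> : n%:R = Num.sqrt (n%:R ^+ 2) :> R.
    by rewrite sqrtr_sqr ger0_norm.
  apply: bound; rewrite ?exprn_gt0 ?ltr0n//; try lia.
  by rewrite -natrX ler_nat; lia.
(* For [n, k >= 2] the weight is at least [3 ^ 2 + 1 ^ 2 = 10]. *)
- by move=> n k n2 kp; apply: bound; rewrite ?ltr0n ?ler_nat//; nia.
(* For [n = 1] and [k >= 2] the weight is at least [2 ^ 2 + 1 ^ 2 = 5]. *)
- by move=> k kp; apply: bound; rewrite ?ltr0n ?ler_nat//; nia.
Qed.
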